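(* Let $\ell$ be a prime power and let $m$ be an integer with $2(\ell-1)<m<\ell^2-\ell-1$. Let $d$ be the minimum distance of $C(D,m(\ell^3+1)P_{\infty})^{\bot}$. The number of minimum weight codewords in $C(D,m(\ell^3+1)P_{\infty})^{\bot}$ satisfies $$A_{d}\left(C(D,m(\ell^3+1)P_{\infty})^{\bot}\right)\ge(\ell+1)(\ell^5-\ell^3)(\ell^6-1)\binom{\ell^2-\ell+1}{d}.$$
   Context: $\ell=p^h$ with $p$ prime and $h\ge 1$. The Giulietti-Korchmáros curve $\mathcal{GK}$ is the non-singular projective curve in $PG(3,\ell^6)$ (homogeneous coordinates $(X:Y:Z:T)$, affine points given by $T=1$) with affine equations $$Z^{\ell^2-\ell+1}=Y^{\ell^2}-Y,\qquad Y^{\ell+1}=X^\ell+X,$$ having a unique point at infinity $P_\infty=(1:0:0:0)$; $\mathcal{GK}(\mathbb{F}_{\ell^6})$ is the set of its $\mathbb{F}_{\ell^6}$-rational points, of size $\ell^8-\ell^6+\ell^5+1$. Let $D=\sum_{P\in \mathcal{GK}(\mathbb{F}_{\ell^6})\setminus\{P_\infty\}}P=P_1+\cdots+P_n$. For a divisor $G=sP_\infty$, $\mathcal{L}(G)=\{f\in\mathbb{F}_{\ell^6}(\mathcal{GK}) : (f)+G\ge 0\}\cup\{0\}$ is the Riemann-Roch space, $C(D,G)=\{(f(P_1),\dots,f(P_n)) : f\in\mathcal{L}(G)\}\subseteq \mathbb{F}_{\ell^6}^n$ is the associated Algebraic-Geometric code, and $C(D,G)^{\bot}$ is its dual with respect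 to the standard inner product. The minimum distance of a linear code is the minimum Hamming weight of its nonzero codewords, and $A_w(C)$ denotes the number of codewords of Hamming weight $w$ in the code $C$. *)

(* Defs.v *)
From HB Require Import structures.
From mathcomp Require Import all_boot all_order all_algebra.
From mathcomp Require Import boolp.
From mathcomp Require Import mpoly.
Set Implicit Arguments.
Unset Strict Implicit.
Unset Printing Implicit Defensive.
Import Order.TTheory GRing.Theory Num.Theory.
Local Open Scope ring_scope.

Section LinearCodes.
Variables (K : finFieldType) (n : nat).
Implicit Types (C : {set 'rV[K]_n}) (c : 'rV[K]_n).

Definition hamming_weight c : nat := #|[set i | c 0 i != 0]|.

Definition dual_code C : {set 'rV[K]_n} :=
  [set c : 'rV[K]_n | [forall c' in C, \sum_i c 0 i * c' 0 i == 0]].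

(* Every weight is at most n, so the neutral element n is harmless; it is the
   value returned for the zero code, which has no minimum distance. *)
Definition min_distance C : nat :=
  \big[minn/n]_(c in C | c != 0) hamming_weight c.

Definition weight_count C (w : nat) : nat :=
  #|[set c in C | hamming_weight c == w]|.

End LinearCodes.

Section GKEquations.
Variables (l : nat) (K : fieldType).

Definition iX : 'I_3 := inord 0.
Definition iY : 'I_3 := inord 1.
Definition iZ : 'I_3 := inord 2.

Definition GK_eq1 : {mpoly K[3]} :=
  'X_iZ ^+ (l ^ 2 - l + 1) - ('X_iY ^+ (l ^ 2) - 'X_iY).
Definition GK_eq2 : {mpoly K[3]} :=
  'X_iY ^+ (l + 1) - ('X_iX ^+ l + 'X_iX).

(* A function field of the curve: a field which is the field of fractions of
   the coordinate ring K[X,Y,Z] / (GK_eq1, GK_eq2), given by the constants and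
   the coordinate functions x, y, z. It is unique up to isomorphism. *)
Record GK_function_field := GKFunctionField {
  ff_sort :> fieldType;
  ff_const : {rmorphism K -> ff_sort};
  ff_coord : 'I_3 -> ff_sort;
  ff_ker : forall q : {mpoly K[3]},
    mmap ff_const ff_coord q = 0 <->
    exists a b : {mpoly K[3]}, q = a * GK_eq1 + b * GK_eq2;
  ff_frac : forall f : ff_sort, exists a b : {mpoly K[3]},
    mmap ff_const ff_coord b != 0 /\
    f = mmap ff_const ff_coord a / mmap ff_const ff_coord b }.

End GKEquations.

Section Places.
Variables (l : nat) (K : fieldType) (F : GK_function_field l K).

Definition ff_eval (q : {mpoly K[3]}) : F := mmap (ff_const F) (ff_coord F) q.

(* A place of F / K is given by its normalized discrete valuation, trivial on
   K. The value at 0, mathematically +oo, is set to 0 and never used. *)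
Record place := Place {
  val_at :> F -> int;
  val_at0 : val_at 0 = 0;
  val_atM : forall f g, f != 0 -> g != 0 -> val_at (f * g) = val_at f + val_at g;
  val_atD : forall f g, f != 0 -> g != 0 -> f + g != 0 ->
    Num.min (val_at f) (val_at g) <= val_at (f + g);
  val_at_const : forall c : K, c != 0 -> val_at (ff_const F c) = 0;
  val_at_normalized : exists2 t, t != 0 & val_at t = 1 }.

Definition vanishes_at (P : place) (f : F) : Prop := f = 0 \/ 0 < P f.

(* P is centred at (1 : 0 : 0 : 0), the coordinates being (x : y : z : 1). *)
Definition is_Pinf (P : place) : Prop :=
  [/\ vanishes_at P (ff_coord F iY / ff_coord F iX),
      vanishes_at P (ff_coord F iZ / ff_coord F iX) &
      vanishes_at P (ff_coord F iX)^-1].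

(* Divisors are given by their coefficient functions. *)
Definition divisor := place -> int.

Definition principal_divisor (f : F) : divisor := fun P => P f.

Definition Pinf_divisor (s : int) : divisor :=
  fun P => if `[< is_Pinf P >] then s else 0.

Definition riemann_roch_space (G : divisor) (f : F) : Prop :=
  f = 0 \/ forall P : place, 0 <= principal_divisor f P + G P.

(* f is regular at the affine point Q, with f(Q) = c. *)
Definition has_value_at (f : F) (Q : 'I_3 -> K) (c : K) : Prop :=
  exists a b : {mpoly K[3]},
    [/\ b.@[Q] != 0, ff_eval b != 0, f = ff_eval a / ff_eval b
      & c = a.@[Q] / b.@[Q]].

End Places.

Arguments Pinf_divisor {l K} F s.

Section GKCodes.
Variables (l : nat) (K : finFieldType).

(* The support of D: since (1 : 0 : 0 : 0) is the only point at infinity, the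
   other rational points are the affine ones. *)
Definition GK_affine_points : {set {ffun 'I_3 -> K}} :=
  [set Q : {ffun 'I_3 -> K} |
    ((GK_eq1 l K).@[Q] == 0) && ((GK_eq2 l K).@[Q] == 0)].

Definition GK_point (i : 'I_#|GK_affine_points|) : {ffun 'I_3 -> K} :=
  enum_val i.

Definition ag_code (F : GK_function_field l K) (G : divisor F) :
    {set 'rV[K]_#|GK_affine_points|} :=
  [set c : 'rV[K]_#|GK_affine_points| |
    `[< exists2 f : F, riemann_roch_space G f &
          forall i, has_value_at f (GK_point i) (c 0 i) >]].

End GKCodes.

(* Main.v *)
Require Import Defs.
From HB Require Import structures.
From mathcomp Require Import all_boot all_order all_algebra.
From mathcomp Require Import finfield closed_field.
From mathcomp Require Import boolp.
From mathcomp Require Import mpoly.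
From mathcomp Require Import zify ring.

(* The dual code has minimum distance m + 2, and the points of the curve on a
   line X = a, Y = b already support enough words of that weight.
   - Products of m linear forms lie in the Riemann-Roch space and separate any
     m + 1 affine points, so no nonzero dual word has weight at most m + 1.
   - Conversely a function f of the Riemann-Roch space is a sum of terms
     s_ij(z) x^i y^j with i < l, j < l^2 and deg s_ij <= m: the translations
     (x, y, z) -> (x + b^l y + c, y + b, z) and divided differences bring the
     coefficients, a priori in K(z), into K[z]; at infinity the monomials
     x^i y^j z^k have pairwise distinct pole orders, so no cancellation hides a
     coefficient of high degree. On X = a, Y = b such an f is a polynomial of
     degree at most m in z, so the Lagrange weights of any m + 2 points of the
     line form a dual word, unique up to a scalar.
   - The lines with l^2 - l + 1 rational points are those with v = w^(l^2 - 1),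
     w = b^(l^2) - b, a root of v^(l+1) + v^l + 1: there are l + 1 values of v,
     each with l^2 - 1 values of w, each with l^2 values of b and l of a.
   The places needed come from embeddings of the function field into Laurent
   series over the algebraic closure: z - c is a local parameter at every affine
   point, where y and then x solve Artin-Schreier equations over the power
   series ring; the point at infinity is the image of the origin under the
   involution (x, y, z) -> (1/x, y/x, -z/x). *)

Set Implicit Arguments.
Unset Strict Implicit.
Unset Printing Implicit Defensive.
Import Order.TTheory GRing.Theory Num.Theory.
Local Open Scope ring_scope.

(** * Rational points on vertical lines *)


Lemma card_preim_fibers (T T' : finType) (f : T -> T') (B : {set T'}) n :
  (forall b, b \in B -> #|[set a | f a == b]| = n) ->
  #|[set a | f a \in B]| = (#|B| * n)%N.
Proof.
move=> fibB; rewrite -sum1_card (partition_big f (mem B)) /=; last first.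
  by move=> a; rewrite inE.
rewrite -sum_nat_const; apply: eq_bigr => b Bb.
rewrite -(fibB b Bb) -sum1_card; apply: eq_bigl => a.
by rewrite !inE andb_idl // => /eqP->.
Qed.

Lemma card_dependent_pairs (T T' : finType) (B : {set T}) (S : T -> {set T'}) n :
  (forall b, b \in B -> #|S b| = n) ->
  #|[set u : T * T' | (u.1 \in B) && (u.2 \in S u.1)]| = (#|B| * n)%N.
Proof.
move=> cardS; rewrite -sum1_card.
rewrite (eq_bigl (fun u : T * T' => (u.1 \in B) && (u.2 \in S u.1))); last first.
  by move=> u; rewrite inE.
rewrite -(pair_big_dep (mem B) (fun b => mem (S b)) (fun _ _ => 1%N)) /=.
by rewrite -sum_nat_const; apply: eq_bigr => b Bb; rewrite sum1_card cardS.
Qed.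

(** * Polynomials that split into distinct linear factors over a finite field *)

Section RootCount.
Variable K : finFieldType.
Implicit Types (P : {poly K}) (c : K).

(** ['X^#|K| - 'X] is the product of the distinct factors ['X - a] over all [a] in [K], so a divisor
    is, up to a unit, a product of some of them. *)
Lemma card_roots_dvd P : P %| 'X^#|K| - 'X ->
  #|[set a | root P a]| = (size P).-1.
Proof.
rewrite finField_genPoly -big_enum => dvdP.
have [ms eqP_ms] := dvdp_prod_XsubC dvdP.
rewrite (eqp_size eqP_ms) size_prod_XsubC /=.
have uniq_ms : uniq (mask ms (enum K)) by rewrite mask_uniq ?enum_uniq.
rewrite -(card_uniqP uniq_ms); apply: eq_card => a.
by rewrite inE (eqp_root eqP_ms) root_prod_XsubC.
Qed.

(** Since c^r = 1, the polynomial X^n - c divides X^(nr) - c^r = X^(|K|-1) - 1. *)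
Lemma card_pow_eq (n r : nat) c : (0 < n)%N -> (n * r)%N = #|K|.-1 ->
  c ^+ r = 1 -> #|[set a | a ^+ n == c]| = n.
Proof.
move=> n_gt0 nr cr.
have -> : [set a | a ^+ n == c] = [set a | root ('X^n - c%:P) a].
  by apply/setP => a; rewrite !inE rootE !hornerE subr_eq0.
rewrite card_roots_dvd ?size_XnsubC //.
have -> : 'X^#|K| - 'X = 'X * (('X^n) ^+ r - (c%:P) ^+ r) :> {poly K}.
  rewrite -exprM nr -polyC_exp cr mulrBr mulr1 -exprS prednK //.
  exact: leq_trans (ltnW (finNzRing_gt1 K)).
by rewrite subrXX mulrCA dvdp_mulr.
Qed.

End RootCount.

Section Frobenius.
Variables (p h l : nat) (hp : prime p) (hh : (0 < h)%N) (hl : l = (p ^ h)%N).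

Lemma prime_power_gt1 : (1 < l)%N.
Proof. by rewrite hl -{1}(expn0 p) ltn_exp2l ?prime_gt1. Qed.

Lemma prime_power_sqr_gt1 : (1 < l ^ 2)%N.
Proof. by rewrite -[1%N](exp1n 2) ltn_sqr prime_power_gt1. Qed.

Lemma pchar_natX (R : nzRingType) (hR : p \in [pchar R]) i :
  [pchar R].-nat (l ^ i)%N.
Proof.
by rewrite hl -expnM pnatX /pnat prime_gt0 //= primes_prime //= hR.
Qed.

Section Ring.
Variables (R : comNzRingType) (hR : p \in [pchar R]).
Implicit Types x y : R.

Lemma frobD i x y : (x + y) ^+ (l ^ i) = x ^+ (l ^ i) + y ^+ (l ^ i).
Proof. exact/exprDn_pchar/pchar_natX. Qed.

Lemma frobN i x : (- x) ^+ (l ^ i) = - x ^+ (l ^ i).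
Proof. exact/exprNn_pchar/pchar_natX. Qed.

Lemma frobB i x y : (x - y) ^+ (l ^ i) = x ^+ (l ^ i) - y ^+ (l ^ i).
Proof. by rewrite frobD frobN. Qed.

Lemma frob1D x y : (x + y) ^+ l = x ^+ l + y ^+ l.
Proof. exact: (frobD 1). Qed.

Lemma frob_sum i (I : Type) (r : seq I) (Q : pred I) (E : I -> R) :
  (\sum_(j <- r | Q j) E j) ^+ (l ^ i) = \sum_(j <- r | Q j) E j ^+ (l ^ i).
Proof.
apply: (big_morph (fun x => x ^+ (l ^ i))); first exact: frobD.
by rewrite expr0n expn_eq0 -leqn0 leqNgt ltnW ?prime_power_gt1.
Qed.

End Ring.

Section Lines.
Variables (K : finFieldType) (hK : #|K| = (l ^ 6)%N).
Implicit Types (a b c v w : K).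

Lemma pcharK : p \in [pchar K].
Proof. by apply: (@card_finPcharP _ _ (h * 6)) => //; rewrite hK hl -expnM. Qed.

Let hPK : p \in [pchar {poly K}].
Proof. by rewrite pchar_poly pcharK. Qed.

(** On c = a^l + a this alternating sum telescopes to a - a^(l^6) = 0; its kernel is exactly the
    image of a -> a^l + a. *)
Definition alt_trace c :=
  c - c ^+ l + c ^+ (l ^ 2) - c ^+ (l ^ 3) + c ^+ (l ^ 4) - c ^+ (l ^ 5).

Lemma card_artin_schreier c : alt_trace c = 0 ->
  #|[set a | a ^+ l + a == c]| = l.
Proof.
move=> c0; pose S : {poly K} := 'X^l + 'X.
have sS : size (S - c%:P) = l.+1.
  rewrite /S -addrA size_polyDl size_polyXn //.
  by rewrite size_XsubC ltnS prime_power_gt1.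
have -> : [set a | a ^+ l + a == c] = [set a | root (S - c%:P) a].
  by apply/setP => a; rewrite !inE rootE /S !hornerE subr_eq0.
rewrite card_roots_dvd ?sS //.
have dvdS n : S - c%:P %| S ^+ n - (c ^+ n)%:P.
  by rewrite polyC_exp subrXX dvdp_mulr.
have Sl i : S ^+ (l ^ i) = 'X^(l ^ i.+1) + 'X^(l ^ i).
  by rewrite /S frobD // -exprM expnS.
(* The alternating sum of the S^(l^i) telescopes to X^(l^6) - X and the constants add up to zero by
   hypothesis; every summand is a multiple of S - c. *)
have -> : 'X^#|K| - 'X = (S ^+ (l ^ 5) - (c ^+ (l ^ 5))%:P)
   - (S ^+ (l ^ 4) - (c ^+ (l ^ 4))%:P) + (S ^+ (l ^ 3) - (c ^+ (l ^ 3))%:P)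
   - (S ^+ (l ^ 2) - (c ^+ (l ^ 2))%:P) + (S ^+ (l ^ 1) - (c ^+ (l ^ 1))%:P)
   - (S ^+ (l ^ 0) - (c ^+ (l ^ 0))%:P).
  have c0' := congr1 polyC c0.
  rewrite /alt_trace !(rmorphD, rmorphB, rmorphN) /= rmorph0 in c0'.
  rewrite !Sl !expn1 expn0 !expr1 hK; apply/eqP; rewrite -subr_eq0; apply/eqP.
  rewrite -[RHS]oppr0 -c0'; ring.
by do ![exact: dvdS | apply: dvdp_sub | apply: dvdp_add].
Qed.

(** Additive Hilbert 90 for the extension of degree 3 over the field with l^2 elements: the
    hypothesis is that [w] has trace 0, and the same telescoping shows that X^(l^2) - X - w
    splits. *)
Lemma card_trace_fiber w : w ^+ (l ^ 4) + w ^+ (l ^ 2) + w = 0 ->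
  #|[set b | b ^+ (l ^ 2) - b == w]| = (l ^ 2)%N.
Proof.
move=> w0; pose S : {poly K} := 'X^(l ^ 2) - 'X.
have sS : size (S - w%:P) = (l ^ 2).+1.
  rewrite /S -addrA size_polyDl size_polyXn //.
  rewrite -opprD size_polyN size_XaddC ltnS.
  exact: prime_power_sqr_gt1.
have -> : [set b | b ^+ (l ^ 2) - b == w] = [set a | root (S - w%:P) a].
  by apply/setP => a; rewrite !inE rootE /S !hornerE subr_eq0.
rewrite card_roots_dvd ?sS //.
have dvdS n : S - w%:P %| S ^+ n - (w ^+ n)%:P.
  by rewrite polyC_exp subrXX dvdp_mulr.
have Sl i : S ^+ (l ^ i) = 'X^(l ^ i.+2) - 'X^(l ^ i).
  by rewrite /S frobB // -exprM -expnD add2n.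
have -> : 'X^#|K| - 'X = (S ^+ (l ^ 4) - (w ^+ (l ^ 4))%:P)
   + (S ^+ (l ^ 2) - (w ^+ (l ^ 2))%:P) + (S ^+ (l ^ 0) - (w ^+ (l ^ 0))%:P).
  have w0' := congr1 polyC w0; rewrite !rmorphD /= rmorph0 in w0'.
  rewrite !Sl expn0 !expr1 hK; apply/eqP; rewrite -subr_eq0; apply/eqP.
  rewrite -[RHS]w0'; ring.
by do ![exact: dvdS | apply: dvdp_sub | apply: dvdp_add].
Qed.

(** For v = w^(l^2-1), trace 0 of w reads 1 + v + v^(l^2+1) = 0, and w is an (l^2-l+1)-th power when
    v^(l^2+l+1) = 1. The second condition turns the first into the equation used here, which in turn
    implies both. *)
Definition vset : {set K} := [set v | v ^+ (l + 1) + v ^+ l + 1 == 0].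

(** Subtracting the l-th power of the equation from v^(l^2) times the equation leaves v^(l^2+l+1) -
    1. *)
Lemma vset_norm v : v \in vset -> v ^+ (l ^ 2 + l + 1) = 1.
Proof.
rewrite inE => /eqP v0.
have /eqP := congr1 (fun x => x ^+ l) v0.
rewrite /= !(frob1D pcharK) expr1n -!exprM expr0n.
rewrite -[l == 0]leqn0 leqNgt (ltnW prime_power_gt1) /= => /eqP v1.
have -> : v ^+ (l ^ 2 + l + 1) =
   v ^+ (l ^ 2) * (v ^+ (l + 1) + v ^+ l + 1)
     - (v ^+ ((l + 1) * l) + v ^+ (l * l) + 1) + 1.
  rewrite !mulrDr mulr1 -!exprD mulnDl mul1n !mulnn addnA; ring.
by rewrite v0 v1 mulr0 subr0 add0r.
Qed.

(** The same combination, taken on polynomials, shows that the defining polynomial divides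
    X^(l^2+l+1) - 1, and l^2+l+1 divides l^6 - 1. *)
Lemma card_vset : #|vset| = (l + 1)%N.
Proof.
pose P : {poly K} := 'X^(l + 1) + 'X^l + 1.
have sP : size P = (l + 1).+1.
  rewrite /P -addrA size_polyDl size_polyXn // size_polyDl ?size_polyXn ?addn1 //.
  by rewrite size_poly1 ltnS ltnW ?prime_power_gt1.
have -> : vset = [set a | root P a].
  by apply/setP => a; rewrite !inE rootE /P !hornerE.
rewrite card_roots_dvd ?sP //.
have Pl : P ^+ l = 'X^(l ^ 2 + l) + 'X^(l ^ 2) + 1.
  by rewrite /P !frob1D // expr1n -!exprM mulnDl mul1n mulnn.
have dvd1 : P %| 'X^(l ^ 2 + l + 1) - 1.
  have -> : 'X^(l ^ 2 + l + 1) - 1 = P * 'X^(l ^ 2) - P ^+ l.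
    rewrite Pl /P !mulrDl mul1r -!exprD.
    rewrite (addnC (l + 1)%N) (addnC l (l ^ 2)%N) addnA; ring.
  apply: dvdp_sub; first exact: dvdp_mulIl.
  by rewrite -(prednK (ltnW prime_power_gt1)) exprS dvdp_mulIl.
apply: dvdp_trans dvd1 _.
have e6 : #|K| = ((l ^ 2 + l + 1) * ((l - 1) * (l ^ 3 + 1))).+1.
  by rewrite hK; have := prime_power_gt1; rewrite !expnS expn0; nia.
set r := ((l - 1) * _)%N in e6.
have -> : 'X^#|K| - 'X = 'X * ('X^(l ^ 2 + l + 1) ^+ r - 1 ^+ r) :> {poly K}.
  by rewrite e6 exprS expr1n -exprM mulrBr mulr1.
by rewrite subrXX mulrCA dvdp_mulr.
Qed.

Definition wset : {set K} := [set w | w ^+ (l ^ 2 - 1) \in vset].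
Definition bset : {set K} := [set b | b ^+ (l ^ 2) - b \in wset].
(** The pair (b, a) stands for the line X = a, Y = b; Y comes first because the values of X are
    counted over each value of Y. *)
Definition lineset : {set K * K} :=
  [set u | (u.1 \in bset) && (u.2 \in [set a | a ^+ l + a == u.1 ^+ (l + 1)])].

Lemma expK_card b : b ^+ (l ^ 6) = b.
Proof. by rewrite -hK expf_card. Qed.

Lemma wset_neq0 w : w \in wset -> w != 0.
Proof.
rewrite !inE; apply: contraTneq => ->.
have l2 : (0 < l ^ 2 - 1)%N by rewrite subn_gt0 prime_power_sqr_gt1.
rewrite expr0n eqn0Ngt l2 /= !expr0n addn1 /= eqn0Ngt (ltnW prime_power_gt1) /= !add0r.
exact: oner_neq0.
Qed.

(** The exponent is (l^6-1)/(l^2-l+1) = (l^2-1)(l^2+l+1), so this makes [w] an (l^2-l+1)-th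
    power. *)
Lemma wset_norm w : w \in wset -> w ^+ ((l + 1) * (l ^ 3 - 1)) = 1.
Proof.
rewrite inE => /vset_norm; rewrite -exprM => <-; congr (_ ^+ _).
have := prime_power_gt1; rewrite !expnS expn0; nia.
Qed.

Lemma card_line_points w : w \in wset ->
  #|[set z | z ^+ (l ^ 2 - l + 1) == w]| = (l ^ 2 - l + 1)%N.
Proof.
move=> Ww; apply: (@card_pow_eq _ _ ((l + 1) * (l ^ 3 - 1))).
- by rewrite addn1.
- by rewrite hK; have := prime_power_gt1; rewrite !expnS expn0; nia.
- exact: wset_norm.
Qed.

(** With w^(l^2) = w v and w^(l^4) = w v^(l^2+1), the trace times v^l is w times the equation of
    [vset], once v^(l^2+l+1) is replaced by 1. *)
Lemma wset_trace w : w \in wset -> w ^+ (l ^ 4) + w ^+ (l ^ 2) + w = 0.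
Proof.
move=> Ww; have w_neq0 := wset_neq0 Ww; move: Ww; rewrite inE.
set v := w ^+ (l ^ 2 - 1) => Vv.
have e2 : w ^+ (l ^ 2) = w * v.
  by rewrite /v -exprS; congr (_ ^+ _); have := prime_power_gt1; rewrite !expnS expn0; nia.
have e4 : w ^+ (l ^ 4) = w * v * v ^+ (l ^ 2).
  by rewrite (expnM l 2 2) -[((l ^ 2) ^ 2)%N]mulnn exprM e2 exprMn e2.
have v_neq0 : v != 0 by rewrite expf_neq0.
have := vset_norm Vv; move: Vv; rewrite inE => /eqP v0 v1.
have : v ^+ l * (w ^+ (l ^ 4) + w ^+ (l ^ 2) + w) = 0.
  rewrite e4 e2; rewrite -addnA exprD in v1; rewrite exprD expr1 in v1 v0.
  transitivity (w * (v ^+ l * v + v ^+ l + 1)); last by rewrite v0 mulr0.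
  rewrite -v1; ring.
by move/eqP; rewrite mulf_eq0 expf_eq0 (negbTE v_neq0) andbF /= => /eqP.
Qed.

(** As 1 + l^5 exceeds l^2 + l^3 by (l+1)(l^3-1)(l-1), the norm condition gives w^(1+l^5) =
    w^(l^2+l^3). Expanded in w = b^(l^2) - b, the difference of the two sides is minus the
    alternating trace. *)
Lemma bset_alt_trace b : b \in bset -> alt_trace (b ^+ (l + 1)) = 0.
Proof.
rewrite inE => Ww; set w := _ - b in Ww.
have w_neq0 := wset_neq0 Ww; have w1 := wset_norm Ww.
have wi i : w ^+ (l ^ i) = b ^+ (l ^ (2 + i)) - b ^+ (l ^ i).
  by rewrite /w (frobB pcharK) -exprM -expnD.
have b7 : b ^+ (l ^ 7) = b ^+ l by rewrite (expnS l 6) mulnC exprM expK_card.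
have : w ^+ (l ^ 0) * w ^+ (l ^ 5) = w ^+ (l ^ 2) * w ^+ (l ^ 3).
  rewrite -!exprD.
  have -> : (l ^ 0 + l ^ 5 = (l ^ 2 + l ^ 3) + (l + 1) * (l ^ 3 - 1) * (l - 1))%N.
    by have := prime_power_gt1; rewrite !expnS !expn0; nia.
  by rewrite exprD (exprM _ ((l + 1) * (l ^ 3 - 1))) w1 expr1n mulr1.
rewrite !wi !addSn !add0n b7 !expn0 !expr1 => /eqP; rewrite -subr_eq0 => /eqP e.
have bi i : (b ^+ (l + 1)) ^+ (l ^ i) = b ^+ (l ^ i.+1) * b ^+ (l ^ i).
  by rewrite -exprM mulnDl mul1n exprD -expnS.
have b1 : b ^+ (l + 1) = b ^+ l * b by rewrite exprD.
have bl : (b ^+ (l + 1)) ^+ l = b ^+ (l ^ 2) * b ^+ l by rewrite -{1}(bi 1%N).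
rewrite /alt_trace bl !bi b1 expK_card -[RHS]oppr0 -e; ring.
Qed.

Lemma card_lineset : #|lineset| = ((l + 1) * (l ^ 5 - l ^ 3))%N.
Proof.
rewrite (@card_dependent_pairs _ _ bset
  (fun b => [set a | a ^+ l + a == b ^+ (l + 1)]) l); last first.
  by move=> b Bb; apply/card_artin_schreier/bset_alt_trace.
rewrite (@card_preim_fibers _ _ _ wset (l ^ 2)); last first.
  by move=> w Ww; apply/card_trace_fiber/wset_trace.
rewrite (@card_preim_fibers _ _ _ vset (l ^ 2 - 1)); last first.
  move=> v Vv; apply: (@card_pow_eq _ _ ((l ^ 2 + l + 1) * (l ^ 2 - l + 1))).
  - by rewrite subn_gt0 prime_power_sqr_gt1.
  - by rewrite hK; have := prime_power_gt1; rewrite !expnS expn0; nia.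
  - by rewrite exprM vset_norm // expr1n.
by rewrite card_vset; have := prime_power_gt1; rewrite !expnS expn0; nia.
Qed.

End Lines.
End Frobenius.

(** * Power series and Artin-Schreier equations *)


(** A series is its sequence of coefficients; decidable equality and choice on sequences come from
    classical logic. *)
Definition pseries (k : fieldType) : Type := nat -> k.
HB.instance Definition _ (k : fieldType) := gen_eqMixin (pseries k).
HB.instance Definition _ (k : fieldType) := gen_choiceMixin (pseries k).

Section PowerSeries.
Variable k : fieldType.
Implicit Types f g u : pseries k.

Definition ps_of_poly (q : {poly k}) : pseries k := fun n => q`_n.
Definition ps_trunc n f : {poly k} := \poly_(i < n) f i.

Definition ps_add f g : pseries k := fun n => f n + g n.
Definition ps_opp f : pseries k := fun n => - f n.
Definition ps_mul f g : pseries k :=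
  fun n => \sum_(i < n.+1) f i * g (n - i)%N.

(** Coefficients of a product up to degree n depend only on truncations, so the ring laws are
    inherited from polynomials. *)
Lemma ps_mul_trunc f g (P Q : {poly k}) n :
  (forall i, (i <= n)%N -> P`_i = f i) -> (forall i, (i <= n)%N -> Q`_i = g i) ->
  ps_mul f g n = (P * Q)`_n.
Proof.
move=> Pf Qg; rewrite coefM; apply: eq_bigr => i _.
by rewrite Pf ?Qg ?leq_subr // -ltnS.
Qed.

Lemma coef_trunc f n i : (i <= n)%N -> (ps_trunc n.+1 f)`_i = f i.
Proof. by rewrite coef_poly ltnS => ->. Qed.

Lemma coef_truncM f g n i : (i <= n)%N ->
  (ps_trunc n.+1 f * ps_trunc n.+1 g)`_i = ps_mul f g i.
Proof.
by move=> le_in; rewrite -(@ps_mul_trunc f g) // => j le_ji;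
   apply: coef_trunc; apply: leq_trans le_ji le_in.
Qed.

Lemma ps_addA : associative ps_add.
Proof. by move=> f g u; apply/funext => n; apply: addrA. Qed.
Lemma ps_addC : commutative ps_add.
Proof. by move=> f g; apply/funext => n; apply: addrC. Qed.
Lemma ps_add0 : left_id (ps_of_poly 0) ps_add.
Proof. by move=> f; apply/funext => n; rewrite /ps_add /ps_of_poly coef0 add0r. Qed.
Lemma ps_addN : left_inverse (ps_of_poly 0) ps_opp ps_add.
Proof.
by move=> f; apply/funext => n; rewrite /ps_add /ps_of_poly coef0 addNr.
Qed.
Lemma ps_mulC : commutative ps_mul.
Proof.
move=> f g; apply/funext => n.
by rewrite -!(@coef_truncM _ _ n) // mulrC.
Qed.
Lemma ps_mulA : associative ps_mul.
Proof.
move=> f g u; apply/funext => n.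
rewrite (@ps_mul_trunc _ _ (ps_trunc n.+1 f) (ps_trunc n.+1 g * ps_trunc n.+1 u)).
- rewrite (@ps_mul_trunc _ _ (ps_trunc n.+1 f * ps_trunc n.+1 g) (ps_trunc n.+1 u)).
  + by rewrite mulrA.
  + by move=> i; apply: coef_truncM.
  + by move=> i; apply: coef_trunc.
- by move=> i; apply: coef_trunc.
- by move=> i; apply: coef_truncM.
Qed.
Lemma ps_mul1 : left_id (ps_of_poly 1) ps_mul.
Proof.
move=> f; apply/funext => n.
rewrite (@ps_mul_trunc _ _ 1 (ps_trunc n.+1 f)) ?mul1r ?coef_trunc // => i.
exact: coef_trunc.
Qed.
Lemma ps_mulDl : left_distributive ps_mul ps_add.
Proof.
move=> f g u; apply/funext => n; rewrite /ps_mul /ps_add -big_split /=.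
by apply: eq_bigr => i _; rewrite mulrDl.
Qed.
Lemma ps_1neq0 : ps_of_poly 1 != ps_of_poly 0.
Proof.
apply/eqP => /(congr1 (fun f => f 0%N)); rewrite /ps_of_poly coef0 coef1.
by move/eqP; rewrite oner_eq0.
Qed.

HB.instance Definition _ :=
  GRing.isZmodule.Build (pseries k) ps_addA ps_addC ps_add0 ps_addN.
HB.instance Definition _ := GRing.Zmodule_isComNzRing.Build (pseries k)
  ps_mulA ps_mulC ps_mul1 ps_mulDl ps_1neq0.

Lemma ps_coefD f g n : (f + g) n = f n + g n. Proof. by []. Qed.
Lemma ps_coefM f g n : (f * g) n = \sum_(i < n.+1) f i * g (n - i)%N.
Proof. by []. Qed.
Lemma ps_coef0 n : (0 : pseries k) n = 0.
Proof. exact: coef0. Qed.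

Fact ps_of_poly_is_zmod_morphism : zmod_morphism ps_of_poly.
Proof. by move=> P Q; apply/funext => n; rewrite /ps_of_poly coefB. Qed.
Fact ps_of_poly_is_monoid_morphism : monoid_morphism ps_of_poly.
Proof.
split=> // P Q; apply/funext => n.
by rewrite ps_coefM /ps_of_poly coefM.
Qed.
HB.instance Definition _ := GRing.isZmodMorphism.Build {poly k} (pseries k)
  ps_of_poly ps_of_poly_is_zmod_morphism.
HB.instance Definition _ := GRing.isMonoidMorphism.Build {poly k} (pseries k)
  ps_of_poly ps_of_poly_is_monoid_morphism.

Lemma ps_of_poly_inj : injective ps_of_poly.
Proof.
move=> P Q eqPQ; apply/polyP => n.
exact: (congr1 (fun f : pseries k => f n) eqPQ).
Qed.

Lemma ps_neq0P f : f != 0 -> exists n, f n != 0.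
Proof.
move=> f0; apply: contrapT => nf; case/negP: f0; apply/eqP/funext => n.
rewrite ps_coef0; apply/eqP; apply: contrapT => fn; apply: nf; exists n.
exact/negP.
Qed.

(** The order of vanishing, with the dummy value 0 at the zero series. *)
Definition ps_ord f : nat :=
  if pselect (exists n, f n != 0) is left e then ex_minn e else 0%N.

Lemma ps_ordP f : f != 0 ->
  f (ps_ord f) != 0 /\ forall i, (i < ps_ord f)%N -> f i = 0.
Proof.
move=> /ps_neq0P; rewrite /ps_ord; case: pselect => // e _.
case: ex_minnP => n fn0 min_n; split=> // i lt_in; apply/eqP/contraT => fi0.
by have := min_n _ fi0; rewrite leqNgt lt_in.
Qed.

Lemma ps_ord_ge f n : f != 0 -> (forall i, (i < n)%N -> f i = 0) -> (n <= ps_ord f)%N.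
Proof.
move=> /ps_ordP[f0 _] fn; rewrite leqNgt; apply: contra f0 => /fn ->.
exact: eqxx.
Qed.

Lemma ps_ord_eq f n : f n != 0 -> (forall i, (i < n)%N -> f i = 0) -> ps_ord f = n.
Proof.
move=> fn0 fn; have f0 : f != 0.
  by apply: contraNneq fn0 => ->; rewrite ps_coef0.
apply/eqP; rewrite eqn_leq ps_ord_ge // andbT leqNgt; apply: contra fn0 => lt_n.
by have [_ ->] := ps_ordP f0.
Qed.

Lemma ps_ordM_subproof f g : f != 0 -> g != 0 ->
  (f * g) (ps_ord f + ps_ord g)%N != 0 /\
  forall i, (i < ps_ord f + ps_ord g)%N -> (f * g) i = 0.
Proof.
move=> /ps_ordP[f0 fz] /ps_ordP[g0 gz]; split.
  have lt_f : (ps_ord f < (ps_ord f + ps_ord g).+1)%N by rewrite ltnS leq_addr.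
  rewrite ps_coefM (bigD1 (Ordinal lt_f)) //= addKn big1 ?addr0 ?mulf_neq0 //.
  move=> i; rewrite -val_eqE /= => ne_i; case: (ltngtP i (ps_ord f)) ne_i => // lt_i _.
    by rewrite fz ?mul0r.
  by rewrite gz ?mulr0 //; have := ltn_ord i; lia.
move=> i lt_i; rewrite ps_coefM big1 // => j _.
have [lt_j|le_j] := ltnP j (ps_ord f); first by rewrite fz ?mul0r.
by rewrite gz ?mulr0 //; have := ltn_ord j; lia.
Qed.

Lemma ps_mulf_neq0 f g : f != 0 -> g != 0 -> f * g != 0.
Proof.
move=> f0 g0; have [fg _] := ps_ordM_subproof f0 g0.
by apply: contraNneq fg => ->; rewrite ps_coef0.
Qed.

Lemma ps_ordM f g : f != 0 -> g != 0 -> ps_ord (f * g) = (ps_ord f + ps_ord g)%N.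
Proof.
by move=> f0 g0; have [? ?] := ps_ordM_subproof f0 g0; apply: ps_ord_eq.
Qed.

Lemma ps_ordD f g : f != 0 -> g != 0 -> f + g != 0 ->
  (minn (ps_ord f) (ps_ord g) <= ps_ord (f + g)%R)%N.
Proof.
move=> /ps_ordP[_ fz] /ps_ordP[_ gz] fg0; apply: ps_ord_ge => // i.
by rewrite leq_min => /andP[/fz fi /gz gi]; rewrite ps_coefD fi gi addr0.
Qed.

Lemma ps_ord_gt0 f : f != 0 -> f 0%N = 0 -> (0 < ps_ord f)%N.
Proof. by move=> f0 fz; apply: ps_ord_ge => // -[]. Qed.

Lemma ps_ordC (c : k) : c != 0 -> ps_ord (ps_of_poly c%:P) = 0%N.
Proof. by move=> c0; apply: ps_ord_eq; rewrite // /ps_of_poly coefC. Qed.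

Definition ps_coef0_morphism f : k := f 0%N.
Fact ps_coef0_is_zmod_morphism : zmod_morphism ps_coef0_morphism.
Proof. by []. Qed.
Fact ps_coef0_is_monoid_morphism : monoid_morphism ps_coef0_morphism.
Proof.
split=> [|f g]; first by rewrite /ps_coef0_morphism [LHS]coef1.
by rewrite /ps_coef0_morphism ps_coefM big_ord1.
Qed.
HB.instance Definition _ := GRing.isZmodMorphism.Build (pseries k) k
  ps_coef0_morphism ps_coef0_is_zmod_morphism.
HB.instance Definition _ := GRing.isMonoidMorphism.Build (pseries k) k
  ps_coef0_morphism ps_coef0_is_monoid_morphism.

Lemma coef_truncX f n m i : (i <= n)%N -> (ps_trunc n.+1 f ^+ m)`_i = (f ^+ m) i.
Proof.
elim: m i => [|m IHm] i le_in; first by rewrite !expr0.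
rewrite !exprS ps_coefM coefM; apply: eq_bigr => j _.
have lt_j := ltn_ord j.
rewrite coef_trunc ?IHm //; first exact: leq_trans (leq_subr _ _) le_in.
by rewrite (leq_trans _ le_in) // -ltnS.
Qed.

(** * Artin-Schreier equations over power series *)

Section ArtinSchreier.
Variables (p h l : nat) (hp : prime p) (hh : (0 < h)%N) (hl : l = (p ^ h)%N).
Hypothesis hk : p \in [pchar k].

Lemma ps_frob f i n :
  (f ^+ (l ^ i)) n = if (l ^ i %| n)%N then f (n %/ l ^ i)%N ^+ (l ^ i) else 0.
Proof.
have r_gt0 : (0 < l ^ i)%N by rewrite expn_gt0 ltnW // (prime_power_gt1 hp hh hl).
have hkX : p \in [pchar {poly k}] by rewrite pchar_poly.
rewrite -(@coef_truncX f n) // /ps_trunc poly_def (frob_sum hp hh hl) //.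
rewrite coef_sum; under eq_bigr => j _.
  rewrite exprZn -exprM coefZ coefXn; over.
case: ifP => [/dvdnP[d ->]|ndvd]; last first.
  rewrite big1 // => j _; case: eqP => [e|_]; last by rewrite mulr0.
  by rewrite e dvdn_mull in ndvd.
rewrite mulnK //; have lt_d : (d < (d * l ^ i).+1)%N by rewrite ltnS leq_pmulr.
rewrite (bigD1 (Ordinal lt_d)) //= eqxx mulr1 big1 ?addr0 // => j.
rewrite -val_eqE /= => ne_j; case: eqP => [/eqP|_]; last by rewrite mulr0.
by rewrite eqn_pmul2r // eq_sym (negbTE ne_j).
Qed.

(** By [ps_frob] the equation in degree n > 0 reads e f(n) = w(n) - f(n/r)^r, the last term being
    present only when r divides n. As n/r < n this is a recursion, started at a root [a] of the
    equation in degree 0. *)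
Lemma ps_artin_schreier (i : nat) (w : pseries k) (e a : k) : (0 < i)%N ->
  e != 0 -> a ^+ (l ^ i) + e * a = w 0%N ->
  exists2 f : pseries k, f 0%N = a & f ^+ (l ^ i) + ps_of_poly e%:P * f = w.
Proof.
move=> i_gt0 e0 ea; set r := (l ^ i)%N.
have r_gt1 : (1 < r)%N.
  by rewrite -(expn0 l) /r ltn_exp2l // (prime_power_gt1 hp hh hl).
(* The recursion on n is made structural by a fuel argument; by [FE] every fuel above n gives the
   same value. *)
pose F := fix F (fuel n : nat) := if fuel is s.+1 then
  (if n == 0%N then a else
     e^-1 * (w n - if (r %| n)%N then F s (n %/ r)%N ^+ r else 0)) else 0.
have FE s s' n : (n < s)%N -> (n < s')%N -> F s n = F s' n.
  elim: s s' n => [|s IHs] [|s'] //= [|n] //= lt_s lt_s'.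
  have lt_n : (n.+1 %/ r < n.+1)%N by rewrite ltn_Pdiv.
  case: ifP => // _; rewrite (IHs s') //; exact: leq_trans lt_n _.
exists (fun n => F n.+1 n) => //; apply/funext => n.
rewrite ps_coefD ps_frob -/r.
have -> g : (ps_of_poly e%:P * g) n = e * g n.
  rewrite ps_coefM big_ord_recl subn0 big1 ?addr0 /ps_of_poly ?coefC //= => j _.
  by rewrite coefC /= mul0r.
case: n => [|n]; first by rewrite dvdn0 div0n /=.
rewrite [in e * _]/= mulrA divff // mul1r.
case: ifP => _; last by rewrite subr0 add0r.
rewrite (FE (n.+1 %/ r).+1 n.+1) ?ltnSn ?ltn_Pdiv //; first by rewrite addrC subrK.
Qed.

End ArtinSchreier.
End PowerSeries.

(** * The coordinate ring *)


Definition pt3 (T : Type) (a b c : T) : 'I_3 -> T := fun i => nth c [:: a; b] i.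

Lemma pt3X T (a b c : T) : pt3 a b c iX = a.
Proof. by rewrite /pt3 inordK. Qed.
Lemma pt3Y T (a b c : T) : pt3 a b c iY = b.
Proof. by rewrite /pt3 inordK. Qed.
Lemma pt3Z T (a b c : T) : pt3 a b c iZ = c.
Proof. by rewrite /pt3 inordK. Qed.

Lemma ord3_case (i : 'I_3) : [\/ i = iX, i = iY | i = iZ].
Proof.
by case: i => [[|[|[|//]]] lt_i]; [constructor 1 | constructor 2 | constructor 3];
   apply: val_inj; rewrite /= inordK.
Qed.

Lemma mmap_rmorph (n : nat) (R S T : comNzRingType) (rho : {rmorphism S -> T})
    (f : {rmorphism R -> S}) (psi : 'I_n -> S) (q : {mpoly R[n]}) :
  rho (mmap f psi q) = mmap (rho \o f) (rho \o psi) q.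
Proof.
rewrite /mmap rmorph_sum; apply: eq_bigr => u _.
rewrite rmorphM rmorph_prod; congr (_ * _).
by apply: eq_bigr => i _; rewrite rmorphXn.
Qed.

Lemma mmap_horner (n : nat) (R S : comNzRingType) (f : {rmorphism R -> S})
    (psi : 'I_n -> S) (g : {poly R}) (i : 'I_n) :
  mmap f psi (map_poly (@mpolyC n R) g).['X_i] = (map_poly f g).[psi i].
Proof.
rewrite -[LHS](horner_map (mmap f psi)) /= mmapX mmap1U -map_poly_comp; congr (_.[_]).
by apply: eq_map_poly => c; apply: mmapC.
Qed.

(** Points with values in any ring: rational points, power series points (local parametrizations)
    and points over the function field (endomorphisms) are all treated through it. *)
Definition on_GK (l : nat) (S : comNzRingType) (psi : 'I_3 -> S) :=
  psi iZ ^+ (l ^ 2 - l + 1) = psi iY ^+ (l ^ 2) - psi iY /\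
  psi iY ^+ (l + 1) = psi iX ^+ l + psi iX.

Section CoordinateRing.
Variables (l : nat) (K : fieldType) (F : GK_function_field l K).

Local Notation ev := (ff_eval F).
Local Notation x := (ff_coord F iX).
Local Notation y := (ff_coord F iY).
Local Notation z := (ff_coord F iZ).

HB.instance Definition _ := GRing.RMorphism.copy (ff_eval F)
  (mmap (ff_const F) (ff_coord F)).

Lemma ff_evalC c : ev c%:MP = ff_const F c.
Proof. exact: mmapC. Qed.
Lemma ff_evalX i : ev 'X_i = ff_coord F i.
Proof. by rewrite /ff_eval mmapX mmap1U. Qed.

Lemma mmap_GK_eq1 (S : comNzRingType) (f : {rmorphism K -> S}) (psi : 'I_3 -> S) :
  mmap f psi (GK_eq1 l K) =
  psi iZ ^+ (l ^ 2 - l + 1) - (psi iY ^+ (l ^ 2) - psi iY).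
Proof. by rewrite /GK_eq1 !rmorphB !rmorphXn /= !mmapX !mmap1U. Qed.

Lemma mmap_GK_eq2 (S : comNzRingType) (f : {rmorphism K -> S}) (psi : 'I_3 -> S) :
  mmap f psi (GK_eq2 l K) = psi iY ^+ (l + 1) - (psi iX ^+ l + psi iX).
Proof. by rewrite /GK_eq2 rmorphB rmorphD !rmorphXn /= !mmapX !mmap1U. Qed.

Lemma on_GKP (S : comNzRingType) (f : {rmorphism K -> S}) (psi : 'I_3 -> S) :
  on_GK l psi <-> mmap f psi (GK_eq1 l K) = 0 /\ mmap f psi (GK_eq2 l K) = 0.
Proof.
rewrite mmap_GK_eq1 mmap_GK_eq2; split=> -[].
  by move=> -> ->; rewrite !subrr.
by move=> /eqP + /eqP; rewrite !subr_eq0 => /eqP ? /eqP.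
Qed.

Lemma ff_eval_mmap (S : comNzRingType) (f : {rmorphism K -> S}) (psi : 'I_3 -> S) q :
  on_GK l psi -> ev q = 0 -> mmap f psi q = 0.
Proof.
move=> /(on_GKP f)[e1 e2] /ff_ker[a [b ->]].
by rewrite rmorphD !rmorphM /= e1 e2 !mulr0 addr0.
Qed.

Lemma on_GK_coord : on_GK l (ff_coord F).
Proof.
apply/(on_GKP (ff_const F)); split; apply/ff_ker.
  by exists 1, 0; rewrite mul1r mul0r addr0.
by exists 0, 1; rewrite mul1r mul0r add0r.
Qed.

Lemma ff_eqZ : z ^+ (l ^ 2 - l + 1) = y ^+ (l ^ 2) - y.
Proof. by case: on_GK_coord. Qed.
Lemma ff_eqY : y ^+ (l + 1) = x ^+ l + x.
Proof. by case: on_GK_coord. Qed.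

(** The inclusion of K[z], the base ring over which the coordinate ring is integral. *)
Definition zpoly : {poly K} -> F := horner_eval z \o map_poly (ff_const F).
HB.instance Definition _ := GRing.RMorphism.copy zpoly
  (horner_eval z \o map_poly (ff_const F)).

Lemma zpolyE g : zpoly g = (map_poly (ff_const F) g).[z]. Proof. by []. Qed.
Lemma zpolyC c : zpoly c%:P = ff_const F c.
Proof. by rewrite zpolyE map_polyC hornerC. Qed.
Lemma zpolyX : zpoly 'X = z.
Proof. by rewrite zpolyE map_polyX hornerX. Qed.
Lemma zpoly_ev g : zpoly g = ev (map_poly (@mpolyC 3 K) g).['X_iZ].
Proof. by rewrite /ff_eval mmap_horner. Qed.

Hypothesis l_gt1 : (1 < l)%N.

Lemma closed_GK_point (k : closedFieldType) (c : k) :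
  exists a b, on_GK l (pt3 a b c).
Proof.
have l2_gt1 : (1 < l ^ 2)%N by rewrite -[1%N](exp1n 2) ltn_sqr.
pose Q : {poly k} := 'X^(l ^ 2) + (- 'X - (c ^+ (l ^ 2 - l + 1))%:P).
have sQ : size Q != 1%N.
  rewrite size_polyDl size_polyXn; first by rewrite -lt0n in l2_gt1 *; lia.
  by rewrite -opprD size_polyN size_XaddC ltnS.
have /closed_rootP[b] := sQ.
rewrite rootE /Q !hornerE subr_eq0 => /eqP eb.
pose Q2 : {poly k} := 'X^l + ('X - (b ^+ (l + 1))%:P).
have sQ2 : size Q2 != 1%N.
  rewrite size_polyDl size_polyXn; first by lia.
  by rewrite size_XsubC ltnS.
have /closed_rootP[a] := sQ2.
rewrite rootE /Q2 !hornerE subr_eq0 => /eqP ea.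
by exists a, b; rewrite /on_GK pt3X pt3Y pt3Z.
Qed.

(** A relation g(z) = 0 would hold at every point of the curve, but over an algebraically closed
    field z takes every value, in particular one that is not a root of [g]. *)
Lemma zpoly_neq0 (k : closedFieldType) (iota : {rmorphism K -> k}) g :
  g != 0 -> zpoly g != 0.
Proof.
move=> g0; apply/eqP => zg0.
have [c gc] : exists c, ~~ root (map_poly iota g) c.
  (* A root c of g X + 1 satisfies g(c) c = -1, hence is not a root of [g]. *)
  have s1 : size (map_poly iota g * 'X + 1%:P) != 1%N.
    by rewrite size_MXaddC map_poly_eq0 (negbTE g0) /= eqSS size_map_poly size_poly_eq0.
  have /closed_rootP[c] := s1; rewrite rootE !hornerE => rc.
  exists c; rewrite rootE; apply: contraTneq rc => ->.
  by rewrite mul0r add0r oner_eq0.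
have [a [b abc]] := closed_GK_point c.
rewrite zpoly_ev in zg0; have := ff_eval_mmap iota abc zg0.
rewrite mmap_horner pt3Z => gc0.
by rewrite rootE gc0 eqxx in gc.
Qed.

(** The equations of the curve are monic in y over K[z] and in x over K[z, y]. *)
Lemma ff_eval_integral q : integralOver zpoly (ev q).
Proof.
have intz : integralOver zpoly z by rewrite -zpolyX; apply: integral_id.
have intX f n : integralOver zpoly f -> integralOver zpoly (f ^+ n).
  move=> f_int; elim: n => [|n IHn]; first exact: integral1.
  by rewrite exprS; apply: integral_mul.
have l2_gt1 : (1 < l ^ 2)%N by rewrite -[1%N](exp1n 2) ltn_sqr.
have inty : integralOver zpoly y.
  pose Q : {poly F} := 'X^(l ^ 2) + (- 'X - (z ^+ (l ^ 2 - l + 1))%:P).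
  have lt_s : (size (- 'X - (z ^+ (l ^ 2 - l + 1))%:P : {poly F})%R < size ('X^(l ^ 2) : {poly F}))%N.
    by rewrite -opprD size_polyN size_XaddC size_polyXn ltnS.
  apply: (@integral_root_monic _ _ _ _ Q).
  - by rewrite monicE lead_coefDl // lead_coefXn.
  - by rewrite rootE !hornerE ff_eqZ /= subrr.
  - apply: (proj1 (integral_poly _ Q)) => i; rewrite /Q coefD coefB coefN coefXn coefX coefC.
    apply: integral_add; first exact: integral_nat.
    apply: integral_sub; first by apply: integral_opp; apply: integral_nat.
    by case: ifP => _; [apply: intX | apply: integral0].
have intx : integralOver zpoly x.
  pose Q : {poly F} := 'X^l + ('X - (y ^+ (l + 1))%:P).
  have lt_s : (size ('X - (y ^+ (l + 1))%:P : {poly F})%R < size ('X^l : {poly F}))%N.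
    by rewrite size_XsubC size_polyXn ltnS.
  apply: (@integral_root_monic _ _ _ _ Q).
  - by rewrite monicE lead_coefDl // lead_coefXn.
  - by rewrite rootE !hornerE ff_eqY /= subrr.
  - apply: (proj1 (integral_poly _ Q)) => i; rewrite /Q coefD coefB coefXn coefX coefC.
    apply: integral_add; first exact: integral_nat.
    apply: integral_sub; first exact: integral_nat.
    by case: ifP => _; [apply: intX | apply: integral0].
rewrite /ff_eval /mmap; apply: (big_ind (integralOver zpoly)).
- exact: integral0.
- exact: integral_add.
move=> u _; apply: integral_mul.
  by rewrite -zpolyC; apply: integral_id.
apply: (big_ind (integralOver zpoly)).
- exact: integral1.
- exact: integral_mul.
by move=> i _; apply: intX; case: (ord3_case i) => ->.
Qed.

(** In a polynomial equation for u = [ev q] over K[z], powers of u are cancelled until the constant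
    term c is nonzero; then c is a multiple of u in the coordinate ring. Denominators can thus be
    taken in K[z]. *)
Lemma ff_eval_cofactor q : ev q != 0 ->
  exists q' g, g != 0 /\ ev q * ev q' = zpoly g.
Proof.
move=> q0; have [P /monic_neq0] := ff_eval_integral q.
elim/poly_ind: P => [|P c IHP]; first by rewrite eqxx.
rewrite rootE rmorphD rmorphM /= map_polyX map_polyC hornerMXaddC /=.
have [->|c0 _] := eqVneq c 0.
  rewrite addr0 rmorph0 addr0 => PX0; rewrite mulf_eq0 (negbTE q0) orbF => rP.
  by apply: IHP => //; apply: contraNneq PX0 => ->; rewrite mul0r.
have {IHP} [q' ->] : exists q', (map_poly zpoly P).[ev q] = ev q'.
  elim/poly_ind: P {IHP} => [|P d [q' IHP]].
    by exists 0; rewrite !rmorph0 horner0.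
  exists (q' * q + (map_poly (@mpolyC 3 K) d).['X_iZ]).
  rewrite !rmorphD !rmorphM /= map_polyX map_polyC hornerMXaddC IHP.
  by rewrite -zpoly_ev.
rewrite addr_eq0 => /eqP e; exists (- q'), c; split=> //.
by rewrite rmorphN mulrN mulrC e opprK.
Qed.

Lemma ff_fraction (f : F) : exists q g, g != 0 /\ f * zpoly g = ev q.
Proof.
have [a [b [b0 ->]]] := ff_frac f.
have [q' [g [g0 e]]] := ff_eval_cofactor b0.
by exists (a * q'), g; split=> //; rewrite -e rmorphM mulrA divfK.
Qed.

Definition basis_sum (s : 'I_l -> 'I_(l ^ 2) -> {poly K}) : F :=
  \sum_i \sum_j zpoly (s i j) * x ^+ i * y ^+ j.
Definition spanned (f : F) := exists s, f = basis_sum s.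

Lemma spanned0 : spanned 0.
Proof.
exists (fun _ _ => 0); rewrite /basis_sum big1 // => i _; rewrite big1 // => j _.
by rewrite rmorph0 !mul0r.
Qed.

Lemma spannedD f g : spanned f -> spanned g -> spanned (f + g).
Proof.
move=> [s ->] [s' ->]; exists (fun i j => s i j + s' i j).
rewrite /basis_sum -big_split; apply: eq_bigr => i _ /=.
rewrite -big_split; apply: eq_bigr => j _ /=.
by rewrite rmorphD !mulrDl.
Qed.

Lemma spannedZ g f : spanned f -> spanned (zpoly g * f).
Proof.
move=> [s ->]; exists (fun i j => g * s i j).
rewrite /basis_sum mulr_sumr; apply: eq_bigr => i _ /=.
rewrite mulr_sumr; apply: eq_bigr => j _ /=.
by rewrite rmorphM !mulrA.
Qed.

(** The rule x^l = y^(l+1) - x lowers the degree in x at the cost of that in y, and y^(l^2) = y +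
    z^(l^2-l+1) lowers the degree in y alone; hence induction on i first, then on j. *)
Lemma spanned_monomial i j : spanned (x ^+ i * y ^+ j).
Proof.
have l2_gt1 : (1 < l ^ 2)%N by rewrite -[1%N](exp1n 2) ltn_sqr.
elim/ltn_ind: i j => i IHi; elim/ltn_ind => j IHj.
have [lt_i|le_i] := ltnP i l; last first.
  have -> : x ^+ i * y ^+ j = x ^+ (i - l) * y ^+ (l + 1 + j)
     + zpoly (- 1) * (x ^+ (i - l + 1) * y ^+ j).
    have xl : x ^+ l = y ^+ l * y - x by rewrite -exprSr -addn1 ff_eqY addrK.
    rewrite -{1}(subnK le_i) !exprD xl !expr1 rmorphN rmorph1; ring.
  by apply: spannedD; [|apply: spannedZ]; apply: IHi; lia.
have [lt_j|le_j] := ltnP j (l ^ 2); last first.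
  have -> : x ^+ i * y ^+ j = x ^+ i * y ^+ (j - l ^ 2 + 1)
     + zpoly ('X^(l ^ 2 - l + 1)) * (x ^+ i * y ^+ (j - l ^ 2)).
    rewrite rmorphXn /= zpolyX; set zN := z ^+ _.
    have yl : y ^+ (l ^ 2) = zN + y by rewrite /zN ff_eqZ subrK.
    rewrite -{1}(subnK le_j) !exprD yl expr1; ring.
  by apply: spannedD; [|apply: spannedZ]; apply: IHj; lia.
exists (fun i' j' => ((i' == Ordinal lt_i) && (j' == Ordinal lt_j))%:R).
rewrite /basis_sum (bigD1 (Ordinal lt_i)) //= (bigD1 (Ordinal lt_j)) //=.
rewrite !eqxx rmorph1 mul1r [X in _ + X + _]big1 ?addr0; last first.
  by move=> j' /negbTE ->; rewrite rmorph0 !mul0r.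
rewrite big1 ?addr0 // => i' /negbTE ->; rewrite big1 // => j' _.
by rewrite rmorph0 !mul0r.
Qed.

Lemma spanned_ev q : spanned (ev q).
Proof.
rewrite /ff_eval /mmap; apply: (big_ind spanned).
- exact: spanned0.
- exact: spannedD.
move=> u _; rewrite /mmap1 !big_ord_recl big_ord0 mulr1.
have -> : lift ord0 (lift ord0 ord0) = iZ :> 'I_3 by apply: val_inj; rewrite /= inordK.
have -> : lift ord0 ord0 = iY :> 'I_3 by apply: val_inj; rewrite /= inordK.
have -> : ord0 = iX by apply: val_inj; rewrite /= inordK.
rewrite -zpolyC -zpolyX -rmorphXn.
have -> : zpoly (q@_u)%:P * (x ^+ u iX * (y ^+ u iY * zpoly ('X ^+ u iZ))) =
  zpoly ((q@_u)%:P * 'X ^+ u iZ) * (x ^+ u iX * y ^+ u iY) by rewrite rmorphM; ring.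
exact/spannedZ/spanned_monomial.
Qed.

End CoordinateRing.

(** * Morphisms and valuations of the function field *)


Definition transcendental (R S : comNzRingType) (f : {rmorphism R -> S}) (u : S) :=
  forall g : {poly R}, g != 0 -> (map_poly f g).[u] != 0.

Section Extension.
Variables (l : nat) (K : finFieldType) (F : GK_function_field l K).
Hypothesis l_gt1 : (1 < l)%N.

Local Notation ev := (ff_eval F).
Local Notation x := (ff_coord F iX).
Local Notation y := (ff_coord F iY).
Local Notation z := (ff_coord F iZ).
Local Notation cF := (ff_const F).

Lemma zpoly_eq0 g : (zpoly F g == 0) = (g == 0).
Proof.
have [k [iota _]] := countable_algebraic_closure K.
apply/idP/idP => [|/eqP->]; last by rewrite rmorph0.
by apply: contraLR; apply: (zpoly_neq0 F l_gt1 iota).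
Qed.

Section Specialization.
Variables (S : comNzRingType) (f : {rmorphism K -> S}) (psi : 'I_3 -> S).
Hypotheses (psi_GK : on_GK l psi) (psi_tr : transcendental f (psi iZ)).

(** A nonzero [ev q] divides a nonzero polynomial in z, whose image is nonzero when the image of z
    is transcendental. So such a point kills nothing in the coordinate ring and extends to
    fractions. *)
Lemma mmap_eq0 q : (mmap f psi q == 0) = (ev q == 0).
Proof.
apply/idP/idP => [/eqP q0|/eqP]; last by move=> /(ff_eval_mmap f psi_GK)->.
apply: contraT => /(ff_eval_cofactor l_gt1)[q' [g [g0 e]]].
have := psi_tr g0; rewrite -mmap_horner.
have : ev (q * q' - (map_poly (@mpolyC 3 K) g).['X_iZ]) = 0.
  by rewrite rmorphB rmorphM /= e zpoly_ev subrr.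
move=> /(ff_eval_mmap f psi_GK)/eqP; rewrite rmorphB rmorphM /= q0 mul0r sub0r oppr_eq0.
by move=> ->.
Qed.

Lemma mmap_congr q q' : ev q = ev q' -> mmap f psi q = mmap f psi q'.
Proof.
move=> e; apply/eqP; rewrite -subr_eq0 -rmorphB mmap_eq0 rmorphB /= e subrr.
exact: eqxx.
Qed.

End Specialization.

Lemma ff_frac_cid (u : F) :
  { ab : {mpoly K[3]} * {mpoly K[3]} | ev ab.2 != 0 /\ u = ev ab.1 / ev ab.2 }.
Proof. by apply: cid; have [a [b ab]] := ff_frac u; exists (a, b). Qed.

Definition num (u : F) := (sval (ff_frac_cid u)).1.
Definition den (u : F) := (sval (ff_frac_cid u)).2.

Lemma den_neq0 u : ev (den u) != 0.
Proof. by have [] := svalP (ff_frac_cid u). Qed.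
Lemma num_den u : u = ev (num u) / ev (den u).
Proof. by have [] := svalP (ff_frac_cid u). Qed.
Lemma num_neq0 u : u != 0 -> ev (num u) != 0.
Proof. by rewrite {1}(num_den u); apply: contraNneq => ->; rewrite mul0r. Qed.

Lemma ff_morphism (psi : 'I_3 -> F) :
  on_GK l psi -> transcendental cF (psi iZ) ->
  exists sigma : {rmorphism F -> F},
    (forall c, sigma (cF c) = cF c) /\ (forall i, sigma (ff_coord F i) = psi i).
Proof.
move=> psi_GK psi_tr; pose phi : {rmorphism {mpoly K[3]} -> F} := mmap cF psi.
have phi0 q : (phi q == 0) = (ev q == 0) by apply: mmap_eq0.
have phiW q q' : ev q = ev q' -> phi q = phi q' by apply: mmap_congr.
pose s (u : F) := phi (num u) / phi (den u).
(* The value does not depend on the fraction chosen by [num] and [den]; the ring laws then follow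
   from those of fractions. *)
have sE a b : ev b != 0 -> s (ev a / ev b) = phi a / phi b.
  move=> b0; rewrite /s; set u := ev a / ev b.
  have d0 := den_neq0 u; apply/eqP; rewrite eqr_div ?phi0 //.
  rewrite -!rmorphM; apply/eqP/phiW; rewrite !rmorphM; apply/eqP.
  by rewrite -eqr_div // -num_den.
have phi1 : phi 1 = 1 := rmorph1 phi.
have sev a : s (ev a) = phi a.
  by have := sE a 1; rewrite phi1 rmorph1 !divr1 => ->; rewrite ?oner_neq0.
have sB : zmod_morphism s.
  move=> u v; rewrite {1}(num_den u) {1}(num_den v).
  rewrite -mulNr addf_div ?den_neq0 // -(rmorphN (ff_eval F)) -!(rmorphM (ff_eval F)) -(rmorphD (ff_eval F)) sE; last first.
    by rewrite rmorphM mulf_neq0 ?den_neq0.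
  by rewrite rmorphD !rmorphM rmorphN -addf_div ?phi0 ?den_neq0 // mulNr.
have sM : monoid_morphism s.
  split=> [|u v]; first by rewrite -(rmorph1 ev) sev rmorph1.
  rewrite {1}(num_den u) {1}(num_den v) mulf_div -!(rmorphM (ff_eval F)) sE ?rmorphM ?mulf_neq0 ?den_neq0 //.
  by rewrite -mulf_div.
pose sA := GRing.isZmodMorphism.Build F F s sB.
pose sMM := GRing.isMonoidMorphism.Build F F s sM.
pose sigma : {rmorphism F -> F} := HB.pack s sA sMM.
exists sigma; split=> [c|i].
  by rewrite -[in LHS]ff_evalC; apply: (etrans (sev _)); rewrite /phi /= mmapC.
by rewrite -[in LHS]ff_evalX; apply: (etrans (sev _)); rewrite /phi /= mmapX mmap1U.
Qed.

Record is_valuation (w : F -> int) : Prop := IsValuation {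
  valuationM : forall f g : F, f != 0 -> g != 0 -> w (f * g) = w f + w g;
  valuationD : forall f g : F, f != 0 -> g != 0 -> f + g != 0 ->
    Num.min (w f) (w g) <= w (f + g);
  valuation_const : forall c : K, c != 0 -> w (cF c) = 0 }.

(** The point embeds the coordinate ring into power series; the valuation of a fraction is the
    difference of the orders of the images of its numerator and denominator. *)
Lemma series_valuation (k : fieldType) (f : {rmorphism K -> pseries k})
    (psi : 'I_3 -> pseries k) :
  on_GK l psi -> transcendental f (psi iZ) ->
  (forall c : K, c != 0 -> ps_ord (f c) = 0%N) ->
  exists2 w, is_valuation w &
    forall q, ev q != 0 -> w (ev q) = ps_ord (mmap f psi q).
Proof.
move=> psi_GK psi_tr ord_const; pose phi : {rmorphism {mpoly K[3]} -> pseries k} := mmap f psi.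
have phi0 q : (phi q == 0) = (ev q == 0) by apply: mmap_eq0.
have phiW q q' : ev q = ev q' -> phi q = phi q' by apply: mmap_congr.
pose w (u : F) : int := (ps_ord (phi (num u)))%:Z - (ps_ord (phi (den u)))%:Z.
have wE a b : ev a != 0 -> ev b != 0 ->
    w (ev a / ev b) = (ps_ord (phi a))%:Z - (ps_ord (phi b))%:Z.
  move=> a0 b0; rewrite /w; set u := ev a / ev b.
  have d0 := den_neq0 u; have n0 : ev (num u) != 0.
    by apply: num_neq0; rewrite mulf_neq0 ?invr_eq0.
  have : phi (num u) * phi b = phi a * phi (den u).
    rewrite -!rmorphM; apply: phiW; rewrite !rmorphM; apply/eqP.
    by rewrite -eqr_div // -num_den.
  move/(congr1 (@ps_ord k)); rewrite -phi0 in a0; rewrite -phi0 in b0.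
  rewrite -phi0 in d0; rewrite -phi0 in n0.
  rewrite (ps_ordM n0 b0) (ps_ordM a0 d0).
  by move: (ps_ord _) (ps_ord _) (ps_ord _) (ps_ord _) => n1 n2 n3 n4; lia.
have wev a : ev a != 0 -> w (ev a) = ps_ord (phi a).
  move=> a0; have := wE a 1 a0; rewrite !rmorph1 divr1 => ->; rewrite ?oner_neq0 //.
  have -> : 1 = ps_of_poly (1%:P : {poly k}) by rewrite !rmorph1.
  by rewrite ps_ordC ?oner_neq0 // subr0.
exists w => //; split=> [u v u0 v0|u v u0 v0|c c0].
- rewrite {1}(num_den u) {1}(num_den v) mulf_div -!(rmorphM (ff_eval F)).
  rewrite wE ?rmorphM ?mulf_neq0 ?num_neq0 ?den_neq0 //.
  rewrite !ps_ordM ?phi0 ?num_neq0 ?den_neq0 // /w; lia.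
- have [q eq_q] : exists q, q = num u * den v + num v * den u by eexists.
  have evq : ev q = ev (num u) * ev (den v) + ev (num v) * ev (den u).
    by rewrite eq_q rmorphD !rmorphM.
  have phiq : phi q = phi (num u) * phi (den v) + phi (num v) * phi (den u).
    by rewrite eq_q rmorphD !rmorphM.
  rewrite {1 3}(num_den u) {1 3}(num_den v) addf_div ?den_neq0 // -evq => uv0.
  have q0 : ev q != 0 by apply: contraNneq uv0 => ->; rewrite mul0r.
  rewrite -(rmorphM (ff_eval F)) wE //; last by rewrite rmorphM mulf_neq0 ?den_neq0.
  have := q0; rewrite -phi0 phiq => q0'.
  have d0 u' : phi (den u') != 0 by rewrite phi0 den_neq0.
  have nu0 : phi (num u) != 0 by rewrite phi0 num_neq0.
  have nv0 : phi (num v) != 0 by rewrite phi0 num_neq0.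
  have := ps_ordD (ps_mulf_neq0 nu0 (d0 v)) (ps_mulf_neq0 nv0 (d0 u)) q0'.
  rewrite -phiq !(rmorphM phi) (ps_ordM nu0 (d0 v)) (ps_ordM nv0 (d0 u)).
  rewrite (ps_ordM (d0 u) (d0 v)).
  rewrite geq_min /w ge_min => /orP[] le_ord; apply/orP; [left|right]; lia.
- have c0' : ev c%:MP != 0 by rewrite ff_evalC fmorph_eq0.
  by rewrite -ff_evalC wev // /phi /= mmapC ord_const.
Qed.

(** The value group is generated by its least positive element e, and division by e normalizes the
    valuation. *)
Lemma normalize_valuation w : is_valuation w ->
  (exists2 t : F, t != 0 & w t != 0) ->
  exists (P : place F) (e : int), 0 < e /\ forall f : F, f != 0 -> w f = e * P f.
Proof.
move=> [wM wD wC] [t t0 wt0].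
have w1 : w 1 = 0 by rewrite -(rmorph1 cF) wC ?oner_neq0.
have wV (f : F) : f != 0 -> w f^-1 = - w f.
  move=> f0; apply/eqP; rewrite -addr_eq0 -wM ?invr_eq0 // mulVf //.
  by rewrite w1.
have wX (f : F) n : f != 0 -> w (f ^+ n) = n%:Z * w f.
  move=> f0; elim: n => [|n IHn]; first by rewrite expr0 w1 mul0r.
  by rewrite exprS wM ?expf_neq0 // IHn; lia.
have exn : exists n, `[< (0 < n)%N /\ exists2 u : F, u != 0 & w u = n%:Z >].
  have [wt|wt] := leP 0 (w t).
    by exists `|w t|%N; apply/asboolP; split; [lia | exists t => //; lia].
  exists `|w t|%N; apply/asboolP; split; first by lia.
  by exists t^-1; rewrite ?invr_eq0 // wV //; lia.
case: (ex_minnP exn) => e /asboolP[e_gt0 [u u0 wu]] min_e.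
have e0 : e%:Z != 0 by lia.
have dvd_e (f : F) : f != 0 -> w f = e%:Z * (w f %/ e%:Z)%Z.
  move=> f0; have modE := divz_eq (w f) e%:Z.
  have mod_ge := modz_ge0 (w f) e0.
  have mod_lt : (w f %% e%:Z)%Z < e%:Z by have := ltz_mod (w f) e0; lia.
  set q := (w f %/ e%:Z)%Z in modE *; set r := (w f %% e%:Z)%Z in modE mod_ge mod_lt *.
  have [r0|ne] := eqVneq r 0; first by rewrite modE r0 addr0 mulrC.
  have rE : `|r|%N%:Z = r by lia.
  (* A nonzero remainder r is the value of f u^(-q), a positive value below e. *)
  suff /min_e : `[< (0 < `|r|)%N /\
      exists2 v : F, v != 0 & w v = `|r|%N%:Z >] by lia.
  apply/asboolP; split; first by lia.
  have [q_ge|q_lt] := leP 0 q.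
    exists (f * (u ^+ `|q|)^-1); first by rewrite mulf_neq0 ?invr_eq0 ?expf_neq0.
    rewrite wM ?invr_eq0 ?expf_neq0 // wV ?expf_neq0 // wX // wu gez0_abs //; lia.
  exists (f * u ^+ `|q|); first by rewrite mulf_neq0 ?expf_neq0.
  rewrite wM ?expf_neq0 // wX // wu ltz0_abs //; lia.
pose v (f : F) : int := if f == 0 then 0 else (w f %/ e%:Z)%Z.
have vE (f : F) : f != 0 -> w f = e%:Z * v f.
  by move=> f0; rewrite /v (negbTE f0) -dvd_e.
have vM (f g : F) : f != 0 -> g != 0 -> v (f * g) = v f + v g.
  move=> f0 g0; apply: (mulfI e0); rewrite mulrDr -!vE ?mulf_neq0 //.
  exact: wM.
have vD (f g : F) : f != 0 -> g != 0 -> f + g != 0 -> Num.min (v f) (v g) <= v (f + g).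
  move=> f0 g0 fg0; have := wD f g f0 g0 fg0; rewrite !vE //.
  rewrite !ge_min; have : 0 < e%:Z by lia.
  by move=> e_gt; rewrite !ler_pM2l.
have v0 : v 0 = 0 by rewrite /v eqxx.
have vC (c : K) : c != 0 -> v (cF c) = 0.
  by move=> c0; apply: (mulfI e0); rewrite -vE ?fmorph_eq0 // wC // mulr0.
have v1 : exists2 t : F, t != 0 & v t = 1.
  by exists u => //; apply: (mulfI e0); rewrite -vE // wu mulr1.
by exists (Place v0 vM vD vC v1), e%:Z; split; [lia | ].
Qed.

End Extension.

(** * Places *)


Section PlaceTheory.
Variables (l : nat) (K : fieldType) (F : GK_function_field l K) (P : place F).
Implicit Types f g : F.

Lemma placeD f g : f != 0 -> g != 0 -> f + g != 0 -> Num.min (P f) (P g) <= P (f + g).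
Proof. exact: val_atD. Qed.

Lemma place1 : P 1 = 0.
Proof. by rewrite -(rmorph1 (ff_const F)) val_at_const ?oner_neq0. Qed.

Lemma placeV f : P f^-1 = - P f.
Proof.
have [->|f0] := eqVneq f 0; first by rewrite invr0 val_at0 oppr0.
by apply/eqP; rewrite -addr_eq0 -val_atM ?invr_eq0 // mulVf // place1.
Qed.

Lemma placeX f n : f != 0 -> P (f ^+ n) = n%:Z * P f.
Proof.
move=> f0; elim: n => [|n IHn]; first by rewrite expr0 place1 mul0r.
by rewrite exprS val_atM ?expf_neq0 // IHn; lia.
Qed.

Lemma placeN f : P (- f) = P f.
Proof.
have [->|f0] := eqVneq f 0; first by rewrite oppr0.
have e1 : -1 = ff_const F (-1) :> F by rewrite rmorphN rmorph1.
rewrite -mulN1r val_atM ?oppr_eq0 ?oner_neq0 // e1 val_at_const ?add0r //.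
by rewrite oppr_eq0 oner_neq0.
Qed.

(** Gives 0 the value +oo, in place of the dummy value 0 stored in a [place]. *)
Definition vge (n : int) f := (f == 0) || (n <= P f).

Lemma vge0 n : vge n 0. Proof. by rewrite /vge eqxx. Qed.
Lemma vgeE n f : f != 0 -> vge n f = (n <= P f).
Proof. by rewrite /vge => /negbTE->. Qed.
Lemma vgeW m n f : m <= n -> vge n f -> vge m f.
Proof. by move=> le_mn /orP[/eqP->|le_n]; rewrite /vge ?eqxx // (le_trans le_mn) ?orbT. Qed.
Lemma vge_const c : vge 0 (ff_const F c).
Proof.
have [->|c0] := eqVneq c 0; first by rewrite rmorph0 vge0.
by rewrite /vge val_at_const // lexx orbT.
Qed.
Lemma vge1 : vge 0 1. Proof. by rewrite /vge place1 lexx orbT. Qed.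

Lemma vgeD n f g : vge n f -> vge n g -> vge n (f + g).
Proof.
have [->|f0] := eqVneq f 0; first by rewrite add0r.
have [->|g0] := eqVneq g 0; first by rewrite addr0.
rewrite (vgeE _ f0) (vgeE _ g0) => nf ng.
have [->|fg0] := eqVneq (f + g) 0; first exact: vge0.
by rewrite vgeE // (le_trans _ (placeD f0 g0 fg0)) // le_min nf.
Qed.

Lemma vgeN n f : vge n (- f) = vge n f.
Proof. by rewrite /vge oppr_eq0 placeN. Qed.

Lemma vgeB n f g : vge n f -> vge n g -> vge n (f - g).
Proof. by move=> nf ng; apply: vgeD; rewrite ?vgeN. Qed.

Lemma vgeM m n f g : vge m f -> vge n g -> vge (m + n) (f * g).
Proof.
have [->|f0] := eqVneq f 0; first by rewrite mul0r => *; exact: vge0.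
have [->|g0] := eqVneq g 0; first by rewrite mulr0 => *; exact: vge0.
rewrite (vgeE _ f0) (vgeE _ g0) vgeE ?mulf_neq0 // val_atM //.
exact: lerD.
Qed.

Lemma vgeM0 f g : vge 0 f -> vge 0 g -> vge 0 (f * g).
Proof. exact: vgeM. Qed.

Lemma vgeX f n : vge 0 f -> vge 0 (f ^+ n).
Proof.
move=> f_ge; elim: n => [|n IHn]; first exact: vge1.
by rewrite exprS vgeM0.
Qed.

Lemma vge_sum n (I : Type) (r : seq I) (Q : pred I) (E : I -> F) :
  (forall i, Q i -> vge n (E i)) -> vge n (\sum_(i <- r | Q i) E i).
Proof. by move=> nE; apply: (big_ind (vge n)) => // [|f g]; [exact: vge0 | exact: vgeD]. Qed.

Lemma val_addr_small f g : f != 0 -> vge (P f + 1) g ->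
  f + g != 0 /\ P (f + g) = P f.
Proof.
move=> f0 /orP[/eqP->|lt_fg]; first by rewrite addr0.
have [g0|g0] := eqVneq g 0; first by rewrite g0 addr0.
have fg0 : f + g != 0.
  rewrite addr_eq0; apply/eqP => e.
  by move: lt_fg; rewrite e placeN; lia.
split=> //; have := placeD f0 g0 fg0; have := @placeD (f + g) (- g) fg0.
rewrite addrK oppr_eq0 => /(_ g0 f0); rewrite placeN; lia.
Qed.

(* Terms with pairwise distinct values cannot cancel, so the sum has the
   least of their values. *)
Lemma val_sum_distinct (I : finType) (E : I -> F) i :
  (forall i j, E i != 0 -> E j != 0 -> P (E i) = P (E j) -> i = j) ->
  E i != 0 ->
  [/\ \sum_j E j != 0, P (\sum_j E j) <= P (E i) &
      exists2 j, E j != 0 & P (\sum_j E j) = P (E j)].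
Proof.
move=> E_inj Ei0.
have [j Ej0 min_j] := @arg_minP _ _ _ i (fun j => E j != 0) (fun j => P (E j)) Ei0.
have rest : vge (P (E j) + 1) (\sum_(k | k != j) E k).
  apply: vge_sum => k ne_kj; have [->|Ek0] := eqVneq (E k) 0; first exact: vge0.
  rewrite vgeE //; have := min_j k Ek0; rewrite le_eqVlt => /orP[/eqP e|]; last by lia.
  by rewrite (E_inj _ _ Ej0 Ek0 e) eqxx in ne_kj.
have [S0 PS] := val_addr_small Ej0 rest.
rewrite [\sum_k _](bigD1 j) //= S0 PS; split=> //; first exact: min_j.
by exists j.
Qed.

(** The nonzero terms c_i u^i of a polynomial in u have the distinct values i v(u), so they cannot
    cancel. *)
Lemma val_transcendental u : P u != 0 -> transcendental (ff_const F) u.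
Proof.
move=> Pu g g0; have u0 : u != 0 by apply: contraNneq Pu => ->; rewrite val_at0.
rewrite horner_coef size_map_poly.
have lt_g : ((size g).-1 < size g)%N by rewrite ltn_predL lt0n size_poly_eq0.
have term0 (i : 'I_(size g)) :
    (map_poly (ff_const F) g)`_i * u ^+ i != 0 -> g`_i != 0.
  by rewrite coef_map; apply: contraNneq => ->; rewrite raddf0 mul0r.
have valE (i : 'I_(size g)) : g`_i != 0 ->
    P ((map_poly (ff_const F) g)`_i * u ^+ i) = i%:Z * P u.
  move=> gi; rewrite coef_map val_atM ?fmorph_eq0 ?expf_neq0 //.
  by rewrite val_at_const // add0r placeX.
have [] // := @val_sum_distinct _ (fun i : 'I_(size g) => (map_poly (ff_const F) g)`_i * u ^+ i)
  (Ordinal lt_g).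
  move=> i j /term0 gi /term0 gj; rewrite !valE // => /(mulIf Pu) [e].
  exact: val_inj.
rewrite /= coef_map mulf_neq0 ?expf_neq0 // fmorph_eq0.
by rewrite -/(lead_coef g) lead_coef_eq0.
Qed.

End PlaceTheory.

Section Coordinates.
Variables (l : nat) (K : finFieldType) (F : GK_function_field l K).
Hypothesis l_gt1 : (1 < l)%N.

Local Notation ev := (ff_eval F).
Local Notation x := (ff_coord F iX).
Local Notation y := (ff_coord F iY).
Local Notation z := (ff_coord F iZ).
Local Notation cF := (ff_const F).
Local Notation N := (l ^ 2 - l + 1)%N.

Let l2_gt1 : (1 < l ^ 2)%N.
Proof. by rewrite -[1%N](exp1n 2) ltn_sqr. Qed.

Lemma coordZ_neq0 : z != 0.
Proof. by rewrite -(zpolyX F) zpoly_eq0 // polyX_eq0. Qed.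

Lemma coordY_neq0 : y != 0.
Proof.
apply/eqP => y0; have := ff_eqZ F; rewrite y0 expr0n -[_ == _ :> nat]negbK -lt0n ltnW //.
by rewrite subr0 => /eqP; rewrite expf_eq0 (negbTE coordZ_neq0) andbF.
Qed.

Lemma coordX_neq0 : x != 0.
Proof.
apply/eqP => x0; have := ff_eqY F; rewrite x0 expr0n -[_ == _ :> nat]negbK -lt0n ltnW //.
by rewrite addr0 => /eqP; rewrite expf_eq0 (negbTE coordY_neq0) andbF.
Qed.

#[local] Hint Resolve coordX_neq0 coordY_neq0 coordZ_neq0 : core.

Section OnePlace.
Variable P : place F.

(** At a pole the power dominates the linear term, at a zero the linear term dominates; applied to
    both equations of the curve, this fixes the ratios of the values of x, y and z. *)
Lemma val_addX_neg f g n : (1 < n)%N -> f != 0 -> P f < 0 -> P f = P g ->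
  P (f ^+ n + g) = n%:Z * P f.
Proof.
move=> n_gt1 f0 Pf Pfg; have fn0 : f ^+ n != 0 by rewrite expf_neq0.
have small : vge P (P (f ^+ n) + 1) g.
  by rewrite /vge placeX // -Pfg; apply/orP; right; nia.
by have [_ ->] := val_addr_small fn0 small; rewrite placeX.
Qed.

Lemma val_addX_pos f g n : (1 < n)%N -> f != 0 -> g != 0 -> 0 < P f -> P f = P g ->
  P (f ^+ n + g) = P f.
Proof.
move=> n_gt1 f0 g0 Pf Pfg; rewrite addrC.
have small : vge P (P g + 1) (f ^+ n).
  by rewrite /vge placeX // -Pfg; apply/orP; right; nia.
by have [_ ->] := val_addr_small g0 small; rewrite -Pfg.
Qed.

Lemma val_coordY_neg : P x < 0 -> (l + 1)%N%:Z * P y = l%:Z * P x.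
Proof. by move=> Px; rewrite -placeX // ff_eqY val_addX_neg. Qed.

Lemma val_coordZ_neg : P y < 0 -> N%:Z * P z = (l ^ 2)%N%:Z * P y.
Proof. by move=> Py; rewrite -placeX // ff_eqZ val_addX_neg ?placeN. Qed.

Lemma val_coordY_pos : 0 < P x -> (l + 1)%N%:Z * P y = P x.
Proof. by move=> Px; rewrite -placeX // ff_eqY val_addX_pos. Qed.

Lemma val_coordZ_pos : 0 < P y -> N%:Z * P z = P y.
Proof.
by move=> Py; rewrite -placeX // ff_eqZ val_addX_pos ?placeN ?oppr_eq0.
Qed.

Lemma vge_coordX : vge P 0 x -> vge P 0 y /\ vge P 0 z.
Proof.
move=> x_ge.
have y_ge : vge P 0 y.
  rewrite vgeE // leNgt; apply/negP => Py.
  have : vge P 0 (y ^+ (l + 1)) by rewrite ff_eqY; apply: vgeD; rewrite ?vgeX.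
  by rewrite vgeE ?expf_neq0 // placeX //; nia.
split=> //; rewrite vgeE // leNgt; apply/negP => Pz.
have : vge P 0 (z ^+ N) by rewrite ff_eqZ; apply: vgeB; rewrite ?vgeX.
by rewrite vgeE ?expf_neq0 // placeX //; nia.
Qed.

(** At a pole of x, (l+1) v(y) = l v(x) and (l^3+1) v(z) = l^3 v(x), because (l+1)(l^2-l+1) = l^3+1;
    so the pole of x is strictly the largest. *)
Lemma is_PinfE : is_Pinf P <-> P x < 0.
Proof.
split=> [[_ _ [/eqP|]]|Px].
- by rewrite invr_eq0 (negbTE coordX_neq0).
- by rewrite placeV; lia.
have Py := val_coordY_neg Px.
have Py0 : P y < 0 by nia.
have Pz := val_coordZ_neg Py0.
have Pyx : P x < P y by nia.
split; right; rewrite ?val_atM ?invr_eq0 ?placeV //; [lia | | lia].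
rewrite subr_gt0.
have lN : (l <= l ^ 2)%N by rewrite expnS expn1 leq_pmulr // ltnW.
have : (l + 1)%N%:Z * N%:Z * P z = (l ^ 3)%N%:Z * P x.
  have -> : (l ^ 3)%N%:Z = (l ^ 2)%N%:Z * l%:Z by rewrite !expnS expn0; lia.
  by rewrite -mulrA Pz mulrCA Py mulrA.
have -> : (l + 1)%N%:Z * N%:Z = (l ^ 3)%N%:Z + 1 by rewrite !expnS expn0 in lN *; nia.
have : (0 < l ^ 3)%N by rewrite expn_gt0 ltnW.
by move: (l ^ 3)%N => q; nia.
Qed.

Lemma affine_coord_ge0 : ~ is_Pinf P -> [/\ vge P 0 x, vge P 0 y & vge P 0 z].
Proof.
rewrite is_PinfE => /negP; rewrite -leNgt => Px.
have x_ge : vge P 0 x by rewrite vgeE.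
by have [] := vge_coordX x_ge.
Qed.

Lemma vge_ev q : vge P 0 x -> vge P 0 (ev q).
Proof.
move=> x_ge; have [y_ge z_ge] := vge_coordX x_ge.
rewrite /ff_eval /mmap; apply: vge_sum => u _; apply: vgeM0; first exact: vge_const.
apply: (big_ind (vge P 0)) => [|f g|i _]; first exact: vge1.
  exact: vgeM0.
by apply: vgeX; case: (ord3_case i) => ->.
Qed.

End OnePlace.

(** * Places above affine points and at infinity *)

Section Construction.
Variables (p h : nat) (hp : prime p) (hh : (0 < h)%N) (hl : l = (p ^ h)%N).
Hypothesis hpK : p \in [pchar K].

(** The point is lifted to power series by z = c + T, with y and x solved from Artin-Schreier
    equations with constant terms b and a. As c is algebraic, g(z) has positive order, which makes
    the valuation nontrivial. *)
Lemma point_place (k : fieldType) (iota : {rmorphism K -> k}) (a b c : k) (g : {poly K}) :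
  on_GK l (pt3 a b c) -> g != 0 -> root (map_poly iota g) c ->
  exists P : place F, vge P 0 x /\
    forall q, mmap iota (pt3 a b c) q = 0 -> vge P 1 (ev q).
Proof.
move=> []; rewrite pt3X pt3Y pt3Z => eZ eY g0 gc.
have hpk : p \in [pchar k] by rewrite (fmorph_pchar iota).
pose t := ps_of_poly ('X + c%:P : {poly k}).
pose f : {rmorphism K -> pseries k} := @ps_of_poly k \o polyC \o iota.
have [Y Y0 eqY] : exists2 Y : pseries k, Y 0%N = b & Y ^+ (l ^ 2) - Y = t ^+ N.
  have [||Y Y0 eqY] := @ps_artin_schreier k p h l hp hh hl hpk 2 (t ^+ N) (-1) b
    isT; first by rewrite oppr_eq0 oner_neq0.
    rewrite mulN1r -eZ -[RHS]/(ps_coef0_morphism (t ^+ N)) rmorphXn.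
    by rewrite /= /ps_coef0_morphism /t /ps_of_poly coefD coefX coefC add0r.
  by exists Y; rewrite // -eqY !rmorphN !rmorph1 mulN1r.
have [X X0 eqX] : exists2 X : pseries k, X 0%N = a & X ^+ l + X = Y ^+ (l + 1).
  have [||X X0 eqX] := @ps_artin_schreier k p h l hp hh hl hpk 1 (Y ^+ (l + 1)) 1 a
    isT; first by rewrite oner_neq0.
    rewrite mul1r expn1 -eY -[RHS]/(ps_coef0_morphism (Y ^+ (l + 1))) rmorphXn.
    by rewrite /= /ps_coef0_morphism Y0.
  by exists X; rewrite // -eqX !rmorph1 mul1r expn1.
have psi_GK : on_GK l (pt3 X Y t) by rewrite /on_GK pt3X pt3Y pt3Z eqX eqY.
have psi_tr : transcendental f (pt3 X Y t iZ).
  move=> g' g'0; rewrite pt3Z.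
  (* The image of g'(z) is the polynomial g'(T + c), of the same degree as g'. *)
  have -> : (map_poly f g').[t] = ps_of_poly ((map_poly iota g') \Po ('X + c%:P)).
    rewrite /comp_poly -horner_map -!map_poly_comp.
    by congr (_.[_]); apply: eq_map_poly.
  rewrite -(rmorph0 (@ps_of_poly k)) (inj_eq (@ps_of_poly_inj k)).
  rewrite -size_poly_eq0 size_comp_poly2 ?size_XaddC // size_poly_eq0.
  by rewrite map_poly_eq0.
have [] := @series_valuation l K F l_gt1 k f (pt3 X Y t) psi_GK psi_tr.
  by move=> d d0; rewrite /f /= ps_ordC // fmorph_eq0.
move=> w w_val wE.
have coef0 q : mmap f (pt3 X Y t) q 0%N = mmap iota (pt3 a b c) q.
  rewrite -[LHS]/(ps_coef0_morphism _) mmap_rmorph; apply: eq_bigr => u _.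
  congr (_ * _); first by rewrite /= /ps_coef0_morphism /ps_of_poly coefC.
  apply: eq_bigr => i _; congr (_ ^+ _); rewrite /= /ps_coef0_morphism.
  case: (ord3_case i) => ->; rewrite ?pt3X ?pt3Y ?pt3Z // /t /ps_of_poly.
  by rewrite coefD coefX coefC add0r.
have w_gt0 q : ev q != 0 -> mmap iota (pt3 a b c) q = 0 -> 0 < w (ev q).
  move=> q0 qabc; rewrite wE // ltz_nat ps_ord_gt0 ?coef0 //.
  by rewrite (@mmap_eq0 l K F l_gt1 _ f _ psi_GK psi_tr).
pose G := (map_poly (@mpolyC 3 K) g).['X_iZ].
have G0 : ev G != 0 by rewrite -zpoly_ev zpoly_eq0.
have wG : 0 < w (ev G).
  by apply: w_gt0; rewrite // mmap_horner pt3Z; apply/eqP.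
have [|P [e [e_gt0 wP]]] := normalize_valuation l_gt1 w_val.
  by exists (ev G); rewrite // gt_eqF.
exists P; split=> [|q qabc].
  rewrite vgeE // -(pmulr_rge0 _ e_gt0) -wP // -ff_evalX wE //.
  by rewrite ff_evalX.
have [->|q0] := eqVneq (ev q) 0; first exact: vge0.
rewrite vgeE //; have := w_gt0 q q0 qabc; rewrite wP //; nia.
Qed.

(** The composite of a place with an endomorphism is a valuation, nontrivial by hypothesis; e is its
    ramification index. *)
Lemma pullback_place (sigma : {rmorphism F -> F}) (P : place F) :
  (forall c, sigma (cF c) = cF c) -> (exists u, P (sigma u) != 0) ->
  exists (P' : place F) (e : int), 0 < e /\ forall f, P (sigma f) = e * P' f.
Proof.
move=> sigmaC [u Pu]; pose w f := P (sigma f).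
have w_val : is_valuation w.
  split=> [f g f0 g0|f g f0 g0 fg0|c c0]; rewrite /w.
  - by rewrite rmorphM val_atM ?fmorph_eq0.
  - by rewrite rmorphD; apply: val_atD; rewrite -?rmorphD fmorph_eq0.
  - by rewrite sigmaC val_at_const.
have [|P' [e [e_gt0 wP]]] := normalize_valuation l_gt1 w_val.
  by exists u => //; apply: contraNneq Pu => ->; rewrite rmorph0 val_at0.
exists P', e; split=> // f; have [->|f0] := eqVneq f 0; last exact: wP.
by rewrite rmorph0 !val_at0 mulr0.
Qed.

(* The involution (x : y : z : 1) -> (1 : y : -z : x) of the curve exchanges
   the origin and the point at infinity. *)
Lemma exists_Pinf : exists P : place F, is_Pinf P.
Proof.
have N_odd : odd N.
  rewrite addn1 /= oddB; last by rewrite expnS expn1 leq_pmulr // ltnW.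
  by rewrite oddX /= addbb.
have [P [Px0 P_gt0]] : exists P : place F, vge P 0 x /\
    forall q, mmap (@idfun K) (pt3 0 0 0) q = 0 -> vge P 1 (ev q).
  apply: (@point_place K idfun 0 0 0 'X).
  - rewrite /on_GK pt3X pt3Y pt3Z subr0 addr0 !expr0n !addn1 /=.
    by rewrite !eqn0Ngt ltnW // ltnW.
  - by rewrite polyX_eq0.
  - by rewrite map_polyX rootX.
have coord_gt0 i : ff_coord F i != 0 -> 0 < P (ff_coord F i).
  move=> i0; have := P_gt0 'X_i; rewrite ff_evalX vgeE // mmapX mmap1U.
  by move=> /(_ _)/lt_le_trans-> //; case: (ord3_case i) => ->; rewrite ?pt3X ?pt3Y ?pt3Z.
have Px : 0 < P x by apply: coord_gt0.
have Py : 0 < P y by apply: coord_gt0.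
have Pz : 0 < P z by apply: coord_gt0.
have eqx := val_coordY_pos Px.
have eqy := val_coordZ_pos Py.
pose psi := pt3 x^-1 (y / x) (- (z / x)).
have xn0 n : x ^+ n != 0 by rewrite expf_neq0.
have psi_GK : on_GK l psi.
  rewrite /on_GK /psi pt3X pt3Y pt3Z; split; last first.
    rewrite expr_div_n exprVn ff_eqY exprD expr1.
    by move: (x ^+ l) (xn0 l) => xl xl0; field; rewrite xl0 coordX_neq0.
  (* Both sides equal y^(l^2+l+1), by the second equation and its l-th power. *)
  have eY : y ^+ (l ^ 2) * (x ^+ l + x) = y * (x ^+ l + x ^+ (l ^ 2)).
    have -> : x ^+ l + x ^+ (l ^ 2) = (x ^+ l + x) ^+ l.
      rewrite (frob1D hp hl) ?(fmorph_pchar cF) // addrC.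
      by rewrite -exprM mulnn.
    by rewrite -ff_eqY -exprM -exprD -exprS; congr (_ ^+ _); lia.
  have eN : x ^+ N * x ^+ l = x ^+ (l ^ 2) * x.
    by rewrite -exprD -exprSr; congr (_ ^+ _); nia.
  rewrite exprNn -signr_odd N_odd expr1 mulN1r !expr_div_n ff_eqZ.
  move: (x ^+ N) (xn0 N) (x ^+ l) (xn0 l) (x ^+ (l ^ 2)) (xn0 (l ^ 2)%N) eN eY.
  move: (y ^+ (l ^ 2)) => Y xN xN0 xl xl0 xll xll0 eN eY.
  have -> : xN = xll * x / xl by rewrite -eN mulfK.
  apply: (mulIf (x := xll * x)); first by rewrite mulf_neq0.
  transitivity (- (Y - y) * xl); first by field; rewrite xl0 xll0 coordX_neq0.
  transitivity (Y * x - y * xll); last by field; rewrite xll0 coordX_neq0.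
  apply/eqP; rewrite -subr_eq0; apply/eqP.
  transitivity (y * (xl + xll) - Y * (xl + x)); first by ring.
  by rewrite eY subrr.
have psi_tr : transcendental cF (psi iZ).
  rewrite /psi pt3Z; apply: (@val_transcendental _ _ _ P).
  rewrite placeN val_atM ?invr_eq0 // placeV; nia.
have [sigma [sigmaC sigmaE]] := ff_morphism l_gt1 psi_GK psi_tr.
have sx : sigma x = x^-1 by rewrite sigmaE /psi pt3X.
have sy : sigma y = y / x by rewrite sigmaE /psi pt3Y.
have sz : sigma z = - (z / x) by rewrite sigmaE /psi pt3Z.
have [|P' [e [e_gt0 PP']]] := pullback_place sigmaC (P := P).
  by exists x; rewrite sx placeV; lia.
exists P'; apply/is_PinfE; have := PP' x; rewrite sx placeV; nia.
Qed.

End Construction.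
End Coordinates.

(** * Regular functions and the Riemann-Roch space *)


Lemma small_multiple (a q : int) (m : nat) :
  a = m%:Z * q -> - m%:Z < a -> a < m%:Z -> a = 0.
Proof.
move=> -> lo hi; have [q_lt|q_gt|->] := ltrgtP q 0; last by rewrite mulr0.
- nia.
- nia.
Qed.

(** The sum is i modulo l. With i known, division by l leaves j (l^2-l+1) + k l^2, and since
    (l^2-l+1)(l+1) = l^3+1 is 1 modulo l^2, j is determined modulo l^2. *)
Lemma pole_number_inj (l i i' j j' k k' : nat) : (1 < l)%N ->
  (i < l)%N -> (i' < l)%N -> (j < l ^ 2)%N -> (j' < l ^ 2)%N ->
  (i * (l ^ 3 + 1) + j * (l * (l ^ 2 - l + 1)) + k * l ^ 3 =
   i' * (l ^ 3 + 1) + j' * (l * (l ^ 2 - l + 1)) + k' * l ^ 3)%N ->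
  [/\ i = i', j = j' & k = k'].
Proof.
move=> l_gt1 lt_i lt_i' lt_j lt_j'.
have le_l : (l <= l ^ 2)%N by rewrite expnS expn1 leq_pmulr // ltnW.
set N := (l ^ 2 - l + 1)%N; have NE : N%:Z = (l ^ 2)%N%:Z - l%:Z + 1 by rewrite /N; lia.
have -> : (l ^ 3 = l * l ^ 2)%N by rewrite expnS.
have l2E : (l ^ 2)%N%:Z = l%:Z * l%:Z by rewrite !expnS expn0; lia.
move: (l ^ 2)%N N le_l NE l2E lt_j lt_j' => L N le_l NE l2E lt_j lt_j' e.
have ei : i = i'.
  suff : i%:Z - i'%:Z = 0 by lia.
  apply: (@small_multiple _ ((k'%:Z - k%:Z + i'%:Z - i%:Z) * L%:Z + (j'%:Z - j%:Z) * N%:Z) l).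
  - lia.
  - lia.
  - lia.
subst i'.
have ej0 : (j%:Z - j'%:Z) * N%:Z = (k'%:Z - k%:Z) * L%:Z.
  apply: (mulfI (x := l%:Z)); first by lia.
  lia.
have ej : j = j'.
  suff : j%:Z - j'%:Z = 0 by lia.
  apply: (@small_multiple _ ((k'%:Z - k%:Z) * (l%:Z + 1) - (j%:Z - j'%:Z) * l%:Z) L).
  - have : (j%:Z - j'%:Z) * N%:Z * (l%:Z + 1) = (k'%:Z - k%:Z) * L%:Z * (l%:Z + 1).
      by rewrite ej0.
    rewrite NE; nia.
  - lia.
  - lia.
subst j'; split=> //; move: ej0; rewrite subrr mul0r => /esym/eqP.
rewrite mulf_eq0 => /orP[|]; lia.
Qed.

Section Regular.
Variables (p h l : nat) (hp : prime p) (hh : (0 < h)%N) (hl : l = (p ^ h)%N).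
Variables (K : finFieldType) (hK : #|K| = (l ^ 6)%N) (F : GK_function_field l K).

Local Notation ev := (ff_eval F).
Local Notation x := (ff_coord F iX).
Local Notation y := (ff_coord F iY).
Local Notation z := (ff_coord F iZ).
Local Notation cF := (ff_const F).
Local Notation N := (l ^ 2 - l + 1)%N.

Let l_gt1 : (1 < l)%N := prime_power_gt1 hp hh hl.
Let hpK : p \in [pchar K] := pcharK hp hl hK.
Let hpF : p \in [pchar F].
Proof. by rewrite (fmorph_pchar cF). Qed.

Definition affine_regular (f : F) :=
  forall P : place F, ~ is_Pinf P -> vge P 0 f.

Lemma regularD f g : affine_regular f -> affine_regular g -> affine_regular (f + g).
Proof. by move=> rf rg P PI; apply: vgeD; [apply: rf | apply: rg]. Qed.
Lemma regularB f g : affine_regular f -> affine_regular g -> affine_regular (f - g).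
Proof. by move=> rf rg P PI; apply: vgeB; [apply: rf | apply: rg]. Qed.
Lemma regularM f g : affine_regular f -> affine_regular g -> affine_regular (f * g).
Proof. by move=> rf rg P PI; apply: vgeM0; [apply: rf | apply: rg]. Qed.
Lemma regular_const c : affine_regular (cF c).
Proof. by move=> P PI; apply: vge_const. Qed.
Lemma regular_ev q : affine_regular (ev q).
Proof. by move=> P PI; have [Px _ _] := affine_coord_ge0 l_gt1 PI; apply: vge_ev. Qed.
Lemma regular_coord i : affine_regular (ff_coord F i).
Proof. by rewrite -ff_evalX; apply: regular_ev. Qed.

(** The place pulled back from an affine place is affine because [sigma x] has no pole there; if the
    pulled-back valuation is trivial, [sigma f] has value 0. *)
Lemma regular_pullback (sigma : {rmorphism F -> F}) f :
  (forall c, sigma (cF c) = cF c) -> affine_regular (sigma x) ->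
  affine_regular f -> affine_regular (sigma f).
Proof.
move=> sigmaC sx rf P PI.
have [[u Pu]|noP] := pselect (exists u, P (sigma u) != 0); last first.
  rewrite /vge; have [->|Pf] := eqVneq (P (sigma f)) 0; first by rewrite lexx orbT.
  by case: noP; exists f.
have [|P' [e [e_gt0 PP']]] := pullback_place l_gt1 sigmaC (P := P); first by exists u.
have PI' : ~ is_Pinf P'.
  rewrite (is_PinfE l_gt1) => Px; have := sx P PI.
  by rewrite vgeE ?fmorph_eq0 ?coordX_neq0 // PP'; nia.
have := rf P' PI'; rewrite /vge fmorph_eq0 PP' => /orP[->//|Pf].
by apply/orP; right; nia.
Qed.

(* The coefficients are Newton's divided differences of the values, so that only
   differences of nodes are inverted. *)
Lemma regular_coef (H : {poly F}) (s : seq F) :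
  (size H <= size s)%N -> uniq s ->
  {in s &, forall u v, u != v -> affine_regular (u - v)^-1} ->
  {in s, forall u, affine_regular u} ->
  {in s, forall u, affine_regular H.[u]} ->
  forall i, affine_regular H`_i.
Proof.
elim: s H => [|u s IHs] H.
  rewrite leqn0 size_poly_eq0 => /eqP-> _ _ _ _ i; rewrite coef0 -(rmorph0 cF).
  exact: regular_const.
move=> szH /= /andP[us uniq_s] dif reg regH.
have ru : affine_regular u by apply: reg; rewrite mem_head.
have rHu : affine_regular H.[u] by apply: regH; rewrite mem_head.
have /factor_theorem[H1 eH] : root (H - H.[u]%:P) u by rewrite rootE !hornerE subrr.
have HE : H = H1 * ('X - u%:P) + H.[u]%:P by rewrite -eH subrK.
have szH1 : (size H1 <= size s)%N.
  have [->|H10] := eqVneq H1 0; first by rewrite size_poly0.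
  have : (size (H - H.[u]%:P)%R <= maxn (size H) 1)%N.
    rewrite (leq_trans (size_polyD _ _)) // geq_max leq_maxl size_polyN.
    by rewrite leq_max size_polyC_leq1 orbT.
  rewrite eH size_Mmonic ?monicXsubC // size_XsubC addn2 /= leq_max !ltnS leqn0.
  rewrite size_poly_eq0 (negbTE H10) orbF => lt_H1.
  by rewrite -ltnS; apply: leq_trans lt_H1 _.
have regH1 i : affine_regular H1`_i.
  apply: IHs => // [v w vs ws|v vs|v vs].
  - by apply: dif; rewrite in_cons ?vs ?ws orbT.
  - by apply: reg; rewrite in_cons vs orbT.
  have ne_vu : v - u != 0 by rewrite subr_eq0; apply: contraNneq us => <-.
  have -> : H1.[v] = (H.[v] - H.[u]) * (v - u)^-1.
    by rewrite [in X in X - _]HE !hornerE addrK mulfK.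
  have vs' : v \in u :: s by rewrite in_cons vs orbT.
  apply: regularM; first by apply: regularB => //; apply: regH.
  by apply: dif; rewrite ?mem_head // -subr_eq0.
move=> i; rewrite HE mulrBr coefD coefB coefMX coefMC coefC.
have r0 : affine_regular 0 by rewrite -(rmorph0 cF); apply: regular_const.
apply: regularD; last by case: ifP.
by apply: regularB; [case: ifP | apply: regularM].
Qed.

(** Nodes that are translates of one function by constants have constant differences, whose inverses
    are regular. *)
Lemma regular_coef_shift (H : {poly F}) (A : {set K}) u :
  (size H <= #|A|)%N -> affine_regular u ->
  {in A, forall a, affine_regular H.[u + cF a]} ->
  forall i, affine_regular H`_i.
Proof.
move=> szH ru rH; have cF_inj : injective (fun a => u + cF a).
  by move=> a a' /addrI/fmorph_inj.
apply: (@regular_coef H [seq u + cF a | a <- enum A]).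
- by rewrite size_map -cardE.
- by rewrite map_inj_uniq ?enum_uniq.
- move=> _ _ /mapP[a _ ->] /mapP[b _ ->] _.
  have -> : (u + cF a - (u + cF b))^-1 = cF (a - b)^-1.
    by rewrite fmorphV rmorphB opprD addrACA subrr add0r.
  exact: regular_const.
- by move=> _ /mapP[a _ ->]; apply: regularD => //; apply: regular_const.
- by move=> _ /mapP[a + ->]; rewrite mem_enum; apply: rH.
Qed.

(** In (y+b)^(l+1) the cross terms are b y^l and b^l y; they are matched by the summand b^l y of the
    new x, as (b^l y)^l = b y^l. *)
Lemma translation b c : b ^+ (l ^ 2) = b -> c ^+ l + c = b ^+ (l + 1) ->
  exists sigma : {rmorphism F -> F},
    [/\ forall c, sigma (cF c) = cF c, sigma x = x + cF b ^+ l * y + cF c,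
        sigma y = y + cF b, sigma z = z &
        forall f, affine_regular f -> affine_regular (sigma f)].
Proof.
move=> b_fix c_eq; pose psi := pt3 (x + cF b ^+ l * y + cF c) (y + cF b) z.
have cb : cF b ^+ (l ^ 2) = cF b by rewrite -rmorphXn b_fix.
have psi_GK : on_GK l psi.
  rewrite /on_GK /psi pt3X pt3Y pt3Z (frobD hp hl hpF) cb ff_eqZ; split.
    by rewrite opprD addrACA subrr addr0.
  rewrite addn1 exprSr !(frob1D hp hl hpF) exprMn -exprM mulnn cb.
  have -> : x ^+ l = y ^+ l * y - x by rewrite -exprSr -addn1 ff_eqY addrK.
  have := congr1 cF c_eq; rewrite rmorphD !rmorphXn addn1 exprSr /= => ec.
  have -> : cF c ^+ l = cF b ^+ l * cF b - cF c by rewrite -ec addrK.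
  ring.
have psi_tr : transcendental cF (psi iZ).
  by move=> g g0; rewrite /psi pt3Z -zpolyE zpoly_eq0.
have [sigma [sigmaC sigmaE]] := ff_morphism l_gt1 psi_GK psi_tr.
have sx : sigma x = x + cF b ^+ l * y + cF c by rewrite sigmaE /psi pt3X.
exists sigma; split=> //; try by rewrite sigmaE /psi ?pt3Y ?pt3Z.
move=> f rf; apply: regular_pullback => //; rewrite sx -rmorphXn.
apply: regularD; last exact: regular_const.
apply: regularD; first exact: regular_coord.
by apply: regularM; [apply: regular_const | apply: regular_coord].
Qed.

Lemma rmorph_zpoly (sigma : {rmorphism F -> F}) g :
  (forall c, sigma (cF c) = cF c) -> sigma z = z -> sigma (zpoly F g) = zpoly F g.
Proof.
move=> sigmaC sz; rewrite !zpolyE -horner_map /= sz -map_poly_comp.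
by congr (_.[_]); apply: eq_map_poly => c; apply: sigmaC.
Qed.

(** In lowest terms s'/g', a root of g' in the algebraic closure yields an affine place where g'(z)
    vanishes; regularity makes s'(z) vanish there too, against a Bezout relation. *)
Lemma regular_fraction (s g : {poly K}) : g != 0 ->
  affine_regular (zpoly F s / zpoly F g) -> g %| s.
Proof.
move=> g0 reg; have d0 : gcdp s g != 0 by rewrite gcdp_eq0 (negbTE g0) andbF.
pose s' := s %/ gcdp s g; pose g' := g %/ gcdp s g.
have sE : s = s' * gcdp s g by rewrite divpK ?dvdp_gcdl.
have gE : g = g' * gcdp s g by rewrite divpK ?dvdp_gcdr.
have g'0 : g' != 0 by apply: contraNneq g0 => e; rewrite gE e mul0r.
have cop : coprimep s' g' by rewrite coprimep_div_gcd // g0 orbT.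
have [sz1|sz1] := eqVneq (size g') 1%N.
  rewrite gE; apply: dvdp_trans (dvdp_gcdl s g).
  by rewrite -[X in _ %| X]mul1r dvdp_mul2r // dvdp1 sz1.
have [k [iota _]] := countable_algebraic_closure K.
have /closed_rootP[c gc] : size (map_poly iota g') != 1%N by rewrite size_map_poly.
have [a [b abc]] := closed_GK_point l_gt1 c.
have [P [Px P_gt0]] := point_place F l_gt1 hp hh hl hpK abc g'0 gc.
have PI : ~ is_Pinf P.
  by rewrite (is_PinfE l_gt1) => Px'; move: Px; rewrite vgeE ?coordX_neq0 //; lia.
have Pg : vge P 1 (zpoly F g').
  by rewrite zpoly_ev; apply: P_gt0; rewrite mmap_horner pt3Z; apply/eqP.
have /Bezout_eq1_coprimepP[[u v] /= uv] := cop.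
have Ps : vge P 1 (zpoly F s').
  have -> : zpoly F s' = (zpoly F s / zpoly F g) * zpoly F g'.
    have -> : zpoly F s = zpoly F s' * zpoly F (gcdp s g) by rewrite -rmorphM -sE.
    have -> : zpoly F g = zpoly F g' * zpoly F (gcdp s g) by rewrite -rmorphM -gE.
    by field; rewrite !(zpoly_eq0 F l_gt1) g'0 d0.
  by rewrite -[1]add0r; apply: vgeM => //; apply: reg.
have zreg w : vge P 0 (zpoly F w) by rewrite zpoly_ev; apply: vge_ev.
have : vge P 1 1.
  rewrite -[in X in vge P 1 X](rmorph1 (zpoly F)) -uv rmorphD !rmorphM /=.
  by apply: vgeD; rewrite -[1]add0r; apply: vgeM.
by rewrite vgeE ?oner_neq0 // place1.
Qed.

Lemma regular_basis_sum f : affine_regular f -> exists s, f = @basis_sum l K F s.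
Proof.
move=> rf; have [q [g [g0 fg]]] := ff_fraction l_gt1 f.
have [s sE] := spanned_ev F l_gt1 q.
have zg0 : zpoly F g != 0 by rewrite zpoly_eq0.
have l_eq0 : (l == 0)%N = false by rewrite -[_ == _]negbK -lt0n ltnW.
pose r i j := zpoly F (s i j) / zpoly F g.
(* [f] is written as G(x), where G has coefficients H_i(y) and H_i has coefficients in K(z). [insub]
   only turns a bounded index into an ordinal. *)
pose H i : {poly F} := \poly_(j < l ^ 2) (if insub j is Some j' then r i j' else 0).
have HE i u : (H i).[u] = \sum_j r i j * u ^+ j.
  rewrite horner_poly; apply: eq_bigr => j _.
  by rewrite insubT // => lt_j; congr (r _ _ * _); apply: val_inj.
pose G : {poly F} := \poly_(i < l) (if insub i is Some i' then (H i').[y] else 0).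
have GE u : G.[u] = \sum_i (H i).[y] * u ^+ i.
  rewrite horner_poly; apply: eq_bigr => i _.
  by rewrite insubT // => lt_i; congr ((H _).[_] * _); apply: val_inj.
have fE : f = G.[x].
  apply: (mulIf zg0); rewrite fg sE /basis_sum GE mulr_suml; apply: eq_bigr => i _.
  rewrite HE !mulr_suml; apply: eq_bigr => j _; rewrite /r.
  by field.
have fix_r (sigma : {rmorphism F -> F}) i j : (forall c, sigma (cF c) = cF c) ->
    sigma z = z -> sigma (r i j) = r i j.
  by move=> sC sz; rewrite /r fmorph_div !rmorph_zpoly.
have regH i : affine_regular (H i).[y].
  have -> : (H i).[y] = G`_i.
    by rewrite coef_poly ltn_ord insubT //= => lt_i; congr (H _).[_]; apply: val_inj.
  (* The translations with b = 0 fix y and z and move x to the l nodes x + a, as many as G has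
     coefficients. *)
  apply: (@regular_coef_shift G [set a : K | a ^+ l + a == 0] x).
  - rewrite (card_artin_schreier hp hh hl hK) ?size_poly // /alt_trace !expr0n.
    by rewrite !expn_eq0 l_eq0 /= !subr0 !addr0.
  - exact: regular_coord.
  move=> a; rewrite inE => /eqP ea.
  have [||sigma [sC sx sy sz sR]] := @translation 0 a.
  - by rewrite expr0n expn_eq0 l_eq0.
  - by rewrite ea expr0n addn1.
  suff -> : G.[x + cF a] = sigma f by apply: sR.
  rewrite fE !GE rmorph_sum; apply: eq_bigr => i' _ /=.
  rewrite !HE rmorphM rmorphXn /= sx rmorph0 expr0n l_eq0 mul0r addr0; congr (_ * _).
  rewrite rmorph_sum; apply: eq_bigr => j' _ /=.
  by rewrite rmorphM rmorphXn /= fix_r // sy rmorph0 addr0.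
have regr i j : affine_regular (r i j).
  have -> : r i j = (H i)`_j.
    by rewrite coef_poly ltn_ord insubT //= => lt_j; congr (r _ _); apply: val_inj.
  apply: (@regular_coef_shift (H i) [set b : K | b ^+ (l ^ 2) - b == 0] y).
  - rewrite (card_trace_fiber hp hh hl hK) ?size_poly //.
    by rewrite !expr0n !expn_eq0 l_eq0 /= !addr0.
  - exact: regular_coord.
  move=> b; rewrite inE subr_eq0 => /eqP eb.
  (* As b^(l^2) = b, the power b^(l+1) is fixed by the l-th power map, so its alternating trace
     cancels in pairs. *)
  have [c ec] : exists c, c ^+ l + c = b ^+ (l + 1).
    have el : (b ^+ (l + 1)) ^+ l = b ^+ (l + 1).
      by rewrite -exprM mulnDl mul1n mulnn exprD eb addn1 exprS.
    have eli i' : (b ^+ (l + 1)) ^+ (l ^ i') = b ^+ (l + 1).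
      by elim: i' => [|i' IHi]; rewrite ?expn0 ?expr1 // expnSr exprM IHi.
    have alt0 : alt_trace l (b ^+ (l + 1)) = 0 by rewrite /alt_trace el !eli; ring.
    have : (0 < #|[set a : K | (a ^+ l + a == b ^+ (l + 1))%R]|)%N.
      by rewrite (card_artin_schreier hp hh hl hK alt0) ltnW.
    by case/card_gt0P => c; rewrite inE => /eqP; exists c.
  have [sigma [sC sx sy sz sR]] := translation eb ec.
  suff -> : (H i).[y + cF b] = sigma (H i).[y] by apply: sR.
  rewrite !HE rmorph_sum; apply: eq_bigr => j' _ /=.
  by rewrite rmorphM rmorphXn /= fix_r // sy.
exists (fun i j => s i j %/ g).
rewrite fE GE /basis_sum; apply: eq_bigr => i _; rewrite HE mulr_suml.
apply: eq_bigr => j _; have dvd := regular_fraction g0 (regr i j).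
rewrite /r -{1}(divpK dvd) rmorphM /= mulfK //; ring.
Qed.

(** * Orders at the point at infinity *)

Section AtInfinity.
Variables (P : place F) (PI : is_Pinf P).
(** The value of z/x, shown below to be 1: z/x is a local parameter at infinity. *)
Let t := P z - P x.

(** The ratios of the values force (v(x), v(y), v(z)) to be proportional to (l^3+1, l(l^2-l+1),
    l^3), whose outer entries differ by 1; so the factor is -t. *)
Lemma Pinf_coord_vals : [/\ 0 < t, P x = - (l ^ 3 + 1)%N%:Z * t,
  P y = - (l * N)%N%:Z * t & P z = - (l ^ 3)%N%:Z * t].
Proof.
have Px : P x < 0 by apply/(is_PinfE l_gt1).
have eY := val_coordY_neg l_gt1 Px.
have Py : P y < 0 by nia.
have eZ := val_coordZ_neg l_gt1 Py.
have le_l : (l <= l ^ 2)%N by rewrite expnS expn1 leq_pmulr // ltnW.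
have NE : N%:Z = l%:Z * l%:Z - l%:Z + 1 by move: le_l; rewrite !expnS expn0; lia.
have l3E : (l ^ 3)%N%:Z = l%:Z * l%:Z * l%:Z by rewrite !expnS expn0; lia.
have l2E : (l ^ 2)%N%:Z = l%:Z * l%:Z by rewrite !expnS expn0; lia.
have e31 : (l ^ 3 + 1)%N%:Z = l%:Z * l%:Z * l%:Z + 1 by rewrite -l3E.
have elN : (l * N)%N%:Z = l%:Z * N%:Z by rewrite PoszM.
have el1 : (l + 1)%N%:Z = l%:Z + 1 by [].
rewrite l2E in eZ; rewrite el1 in eY; rewrite e31 elN l3E /t.
move: N (P x) (P y) (P z) Px eY Py eZ NE {elN} => M X Y Z Px eY Py eZ NE.
pose k := X - Y; have Xk : X = (l%:Z + 1) * k by rewrite /k; lia.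
have Yk : Y = l%:Z * k by rewrite /k; lia.
have kE : k = M%:Z * (X - Z).
  rewrite mulrBr eZ Yk Xk NE; ring.
have XE : X = (l%:Z + 1) * M%:Z * (X - Z) by rewrite {1}Xk {1}kE mulrA.
split.
- suff : X - Z < 0 by lia.
  rewrite ltNge; apply/negP => ge0.
  have : 0 <= (l%:Z + 1) * M%:Z * (X - Z) by rewrite !mulr_ge0.
  by rewrite -XE; lia.
- rewrite {1}XE NE; ring.
- rewrite Yk kE; ring.
- have -> : Z = X - (X - Z) by ring.
  rewrite {1}XE NE; ring.
Qed.

Definition pole_number (i j k : nat) : nat := (i * (l ^ 3 + 1) + j * (l * N) + k * l ^ 3)%N.

(** Expanded into monomials x^i y^j z^k, the nonzero terms have distinct values by
    [pole_number_inj], so the sum has the least of them: at most that of any given term, and a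
    multiple of t. *)
Lemma val_basis_sum (s : 'I_l -> 'I_(l ^ 2) -> {poly K}) i j k :
  (s i j)`_k != 0 ->
  [/\ basis_sum F s != 0, P (basis_sum F s) <= - t * (pole_number i j k)%:Z &
      exists n : int, P (basis_sum F s) = t * n].
Proof.
move=> sk0; pose M := (\max_i' \max_j' size (s i' j'))%N.
have leM i' j' : (size (s i' j') <= M)%N.
  by rewrite (leq_trans _ (leq_bigmax i')) // (leq_bigmax j').
pose I := ('I_l * 'I_(l ^ 2) * 'I_M)%type.
pose E (u : I) := cF (s u.1.1 u.1.2)`_u.2 * x ^+ u.1.1 * y ^+ u.1.2 * z ^+ u.2.
have bE : basis_sum F s = \sum_u E u.
  rewrite -(pair_bigA _ (fun u v => E (u, v))) /=.
  rewrite -(pair_bigA _ (fun u v => \sum_j E ((u, v), j))) /= /basis_sum.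
  apply: eq_bigr => i' _; apply: eq_bigr => j' _.
  rewrite zpolyE (horner_coef_wide _ (n := M)) ?size_map_poly // !mulr_suml.
  by apply: eq_bigr => k' _; rewrite coef_map /E /=; ring.
have [t_gt0 Px Py Pz] := Pinf_coord_vals.
have E0 (u : I) : E u != 0 -> (s u.1.1 u.1.2)`_u.2 != 0.
  by apply: contraNneq => e; rewrite /E e rmorph0 !mul0r.
have x0 := coordX_neq0 F l_gt1; have y0 := coordY_neq0 F l_gt1.
have z0 := coordZ_neq0 F l_gt1.
have valE (u : I) : (s u.1.1 u.1.2)`_u.2 != 0 ->
    P (E u) = - t * (pole_number u.1.1 u.1.2 u.2)%:Z.
  move=> su; have cs0 : cF (s u.1.1 u.1.2)`_u.2 != 0 by rewrite fmorph_eq0.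
  have xn0 := expf_neq0 u.1.1 x0; have yn0 := expf_neq0 u.1.2 y0.
  have zn0 := expf_neq0 u.2 z0; have cx0 := mulf_neq0 cs0 xn0.
  rewrite /E (val_atM P (mulf_neq0 cx0 yn0) zn0) (val_atM P cx0 yn0).
  rewrite (val_atM P cs0 xn0) val_at_const // !placeX // Px Py Pz /pole_number.
  rewrite !PoszD !PoszM; ring.
have E_neq0 (u : I) : (s u.1.1 u.1.2)`_u.2 != 0 -> E u != 0.
  by move=> su; rewrite /E !mulf_neq0 ?expf_neq0 ?fmorph_eq0.
have nt0 : - t != 0 by rewrite oppr_eq0 gt_eqF.
have lt_kM : (k < M)%N.
  by apply: leq_trans (leM i j); rewrite ltnNge; apply: contra sk0 => /(nth_default 0)->.
have [//||] := @val_sum_distinct _ _ _ P _ E (i, j, Ordinal lt_kM).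
- move=> [[i1 j1] k1] [[i2 j2] k2] /E0 s1 /E0 s2; rewrite !valE //= => /(mulfI nt0) [].
  move=> /(pole_number_inj l_gt1 (ltn_ord i1) (ltn_ord i2) (ltn_ord j1) (ltn_ord j2)).
  by move=> [/val_inj-> /val_inj-> /val_inj->].
- exact: E_neq0.
rewrite -bE => S0 le_S [v Ev PS]; split=> //.
  by move: le_S; rewrite valE.
exists (- (pole_number v.1.1 v.1.2 v.2)%:Z).
by rewrite PS valE ?E0 // mulrN mulNr.
Qed.

(** Every function is a quotient of basis sums, so all values are multiples of t, and a normalized
    valuation takes the value 1. *)
Lemma Pinf_uniformizer : t = 1.
Proof.
have [t_gt0 _ _ _] := Pinf_coord_vals.
have dvd_ev q : ev q != 0 -> exists n : int, P (ev q) = t * n.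
  have [s ->] := spanned_ev F l_gt1 q => b0.
  have [i [j [k sk]]] : exists i j k, (s i j)`_k != 0.
    apply: contrapT => no; case/negP: b0; apply/eqP; rewrite /basis_sum.
    apply: big1 => i _; apply: big1 => j _; suff -> : s i j = 0 by rewrite rmorph0 !mul0r.
    apply/polyP => k; rewrite coef0; apply/eqP; apply: contrapT => /negP sk.
    by apply: no; exists i, j, k.
  by have [_ _] := val_basis_sum sk.
have [f f0 Pf] := val_at_normalized P.
have [q [g [g0 fg]]] := ff_fraction l_gt1 f.
have zg0 : zpoly F g != 0 by rewrite zpoly_eq0.
have [n en] : exists n : int, P (ev q) = t * n by apply: dvd_ev; rewrite -fg mulf_neq0.
have [n' en'] : exists n : int, P (zpoly F g) = t * n.
  by rewrite zpoly_ev; apply: dvd_ev; rewrite -zpoly_ev.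
have unit_gt0 (a b : int) : 0 < a -> a * b = 1 -> a = 1.
  move=> a_gt0 ab; have b_gt0 : 0 < b by rewrite -(pmulr_rgt0 _ a_gt0) ab.
  nia.
apply: (unit_gt0 _ (n - n') t_gt0).
by rewrite mulrBr -en -en' -fg val_atM // Pf addrK.
Qed.

End AtInfinity.

Lemma riemann_roch_affine_regular (s : int) f :
  riemann_roch_space (Pinf_divisor F s) f -> affine_regular f.
Proof.
move=> [->|ge] P PI; first exact: vge0.
by have := ge P; rewrite /Pinf_divisor asboolF // addr0 /vge => ->; rewrite orbT.
Qed.

(** A term in z^k forces a pole of order at least k l^3 at infinity, while m (l^3+1) < (m+1) l^3;
    hence k is at most m. *)
Lemma riemann_roch_basis_sum m f : (m < l ^ 3)%N ->
  riemann_roch_space (Pinf_divisor F (m * (l ^ 3 + 1))%N%:Z) f ->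
  exists2 s, f = @basis_sum l K F s & forall i j, (size (s i j) <= m.+1)%N.
Proof.
move=> lt_m RRf; have [s fE] := regular_basis_sum (riemann_roch_affine_regular RRf).
exists s => // i j; apply/leq_sizeP => k lt_mk; apply/eqP; apply: contrapT => /negP sk.
have [P PI] := exists_Pinf F l_gt1 hp hh hl hpK.
have [] := val_basis_sum PI sk; rewrite -fE (Pinf_uniformizer PI) => f0 le_f _.
case: RRf => [e|/(_ P)]; first by rewrite e eqxx in f0.
rewrite /Pinf_divisor /principal_divisor asboolT // => ge_f.
have : (k * l ^ 3 <= m * (l ^ 3 + 1))%N.
  have : (k * l ^ 3 <= pole_number i j k)%N by rewrite leq_addl.
  by move: (pole_number i j k) le_f (m * _)%N (k * _)%N ge_f => a le_f b c ge_f; lia.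
by move: (l ^ 3)%N lt_m => q; nia.
Qed.

(** Among the coordinates x has the largest pole at infinity, of order l^3+1, and no factor has
    another pole. *)
Lemma riemann_roch_prod (r : seq ('I_3 * K)) m : (size r <= m)%N ->
  riemann_roch_space (Pinf_divisor F (m * (l ^ 3 + 1))%N%:Z)
    (\prod_(u <- r) (ff_coord F u.1 - cF u.2)).
Proof.
move=> le_r; set f := \prod_(u <- r) _.
have [->|f0] := eqVneq f 0; first by left.
right=> P; rewrite /principal_divisor /Pinf_divisor.
have vge_prod (n : nat) : (forall u, vge P (- n%:Z) (ff_coord F u.1 - cF u.2)) ->
    vge P (- (size r * n)%N%:Z) f.
  move=> un; rewrite /f; elim: (r) => [|u r' IHr]; first by rewrite big_nil mul0n vge1.
  rewrite big_cons /= mulSn PoszD opprD; exact: vgeM.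
case: asboolP => [PI|nPI].
  have /vge_prod : forall u, vge P (- (l ^ 3 + 1)%N%:Z) (ff_coord F u.1 - cF u.2).
    have [_ Px Py Pz] := Pinf_coord_vals PI; rewrite Pinf_uniformizer // !mulr1 in Px Py Pz.
    move=> u; apply: vgeB; last by apply: vgeW (vge_const _ _); lia.
    have le_l : (l <= l ^ 2)%N by rewrite expnS expn1 leq_pmulr // ltnW.
    case: (ord3_case u.1) => ->; rewrite vgeE ?(coordX_neq0, coordY_neq0, coordZ_neq0) //.
    - by rewrite Px.
    - by rewrite Py; rewrite !expnS !expn0 in le_l *; nia.
    - by rewrite Pz; lia.
  by rewrite vgeE //; move: (l ^ 3 + 1)%N => M; nia.
have /vge_prod : forall u, vge P (- 0%N%:Z) (ff_coord F u.1 - cF u.2).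
  move=> u; rewrite oppr0; apply: vgeB; last exact: vge_const.
  by have := regular_coord u.1 nPI.
by rewrite muln0 oppr0 addr0 vgeE.
Qed.

End Regular.

(** * The code *)


Section LagrangeWeights.
Variables (K : fieldType) (I : finType) (v : I -> K) (T : {set I}).
Hypothesis v_inj : {in T &, injective v}.

(** The barycentric weights of the nodes, which are the column multipliers in the dual of a
    Reed-Solomon code. *)
Definition lagrange_weight i := (\prod_(j in T :\ i) (v i - v j))^-1.

Lemma lagrange_prod_neq0 i : i \in T -> \prod_(j in T :\ i) (v i - v j) != 0.
Proof.
move=> Ti; apply/prodf_neq0 => j; rewrite !inE => /andP[ne_ji Tj].
by rewrite subr_eq0; apply: contra ne_ji => /eqP/v_inj-> //.
Qed.

Lemma lagrange_weight_neq0 i : i \in T -> lagrange_weight i != 0.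
Proof. by move=> Ti; rewrite invr_eq0 lagrange_prod_neq0. Qed.

(* The sum is the coefficient of degree #|T| - 1 in the Lagrange interpolant of
   g, which is g itself. *)
Lemma lagrange_orthogonal (g : {poly K}) : (size g < #|T|)%N ->
  \sum_(i in T) lagrange_weight i * g.[v i] = 0.
Proof.
move=> sg; pose b i : {poly K} := \prod_(j in T :\ i) ('X - (v j)%:P).
have size_b i : i \in T -> size (b i) = #|T|.
  move=> Ti; rewrite /b -big_enum size_prod_XsubC -cardE.
  by rewrite [in RHS](cardsD1 i) Ti.
pose f := \sum_(i in T) (lagrange_weight i * g.[v i]) *: b i.
have fT i : i \in T -> f.[v i] = g.[v i].
  move=> Ti; rewrite /f horner_sum (bigD1 i) //= big1 ?addr0 => [|k /andP[Tk ne_ki]].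
    rewrite hornerZ horner_prod; under eq_bigr => j _ do rewrite hornerXsubC.
    by rewrite mulrAC mulVf ?mul1r // lagrange_prod_neq0.
  rewrite hornerZ horner_prod (bigD1 i) /= ?inE ?Ti 1?eq_sym ?ne_ki //.
  by rewrite hornerXsubC subrr mul0r mulr0.
have fg : f = g.
  apply/eqP; rewrite -subr_eq0; apply/eqP.
  apply: (@roots_geq_poly_eq0 _ _ [seq v i | i <- enum T]).
  - apply/allP => _ /mapP[i + ->]; rewrite mem_enum => Ti.
    by rewrite rootE !hornerE fT // subrr.
  - rewrite map_inj_in_uniq ?enum_uniq // => i j.
    by rewrite !mem_enum; apply: v_inj.
  rewrite size_map -cardE (leq_trans (size_polyD _ _)) // geq_max size_polyN (ltnW sg) andbT.
  apply: leq_trans (size_sum _ _ _) _; apply/bigmax_leqP => i Ti.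
  by rewrite (leq_trans (size_scale_leq _ _)) ?size_b.
transitivity f`_#|T|.-1; last first.
  by rewrite fg nth_default // -ltnS prednK //; apply: leq_ltn_trans sg.
rewrite /f coef_sum; apply: eq_bigr => i Ti.
rewrite coefZ -(size_b i Ti) -/(lead_coef _) (monicP _) ?mulr1 //.
by rewrite /b -big_enum monic_prod_XsubC.
Qed.

End LagrangeWeights.

Lemma min_distance_eq (K : finFieldType) (n w : nat) (C : {set 'rV[K]_n}) :
  (exists c, [/\ c \in C, c != 0 & hamming_weight c = w]) ->
  (forall c, c \in C -> c != 0 -> (w <= hamming_weight c)%N) ->
  min_distance C = w.
Proof.
move=> [c [Cc c0 cw]] w_min; apply/eqP; rewrite eqn_leq; apply/andP; split.
  rewrite -cw /min_distance.
  have : c \in index_enum {: 'rV[K]_n} by rewrite mem_index_enum.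
  elim: (index_enum _) => // c' r IHr; rewrite in_cons big_cons => /orP[/eqP<-|/IHr le_r].
    by rewrite Cc c0 geq_minl.
  by case: ifP => // _; rewrite geq_min le_r orbT.
(* The neutral value n of the minimum is at least w because w is the weight of a word of length
   n. *)
apply: (big_ind (fun d => w <= d)%N) => [|d e|c' /andP[]].
- by rewrite -cw /hamming_weight -[X in (_ <= X)%N]card_ord max_card.
- by rewrite leq_min => -> ->.
- exact: w_min.
Qed.

(** * The dual code and its words supported on vertical lines *)

Section Code.
Variables (p h l m : nat) (hp : prime p) (hh : (0 < h)%N) (hl : l = (p ^ h)%N).
Variables (K : finFieldType) (hK : #|K| = (l ^ 6)%N) (F : GK_function_field l K).
Hypothesis hm : (m < l ^ 2 - l - 1)%N.

Local Notation ev := (ff_eval F).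
Local Notation cF := (ff_const F).
Local Notation N := (l ^ 2 - l + 1)%N.
Local Notation Q := (@GK_point l K).
Local Notation C := (ag_code (Pinf_divisor F (m * (l ^ 3 + 1))%N%:Z)).

Let l_gt1 : (1 < l)%N := prime_power_gt1 hp hh hl.
Let m_small : (m < l ^ 3)%N.
Proof.
have le_l : (l ^ 2 <= l ^ 3)%N by rewrite leq_exp2l.
by apply: leq_trans le_l; apply: leq_trans hm _; rewrite -subnDA leq_subr.
Qed.

Lemma meval_mmap (q : {mpoly K[3]}) (v : 'I_3 -> K) : q.@[v] = mmap idfun v q.
Proof. by []. Qed.

Lemma GK_pointP i : on_GK l (Q i : 'I_3 -> K).
Proof.
apply/(on_GKP l idfun); have := enum_valP i; rewrite inE => /andP[/eqP e1 /eqP e2].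
by rewrite -!meval_mmap.
Qed.

Lemma GK_point_inj : injective Q.
Proof. exact: enum_val_inj. Qed.

Lemma GK_point_surj a b c : on_GK l (pt3 a b c : 'I_3 -> K) ->
  exists i, Q i = pt3 a b c :> ('I_3 -> K).
Proof.
move=> abc; pose q := [ffun i => pt3 a b c i].
have qE : q = pt3 a b c :> ('I_3 -> K) by apply/funext => i; rewrite ffunE.
have Aq : q \in GK_affine_points l K.
  rewrite inE !meval_mmap qE; have [-> ->] := proj1 (on_GKP l idfun _) abc.
  by rewrite !eqxx.
by exists (enum_rank_in Aq q); rewrite /GK_point enum_rankK_in.
Qed.

Lemma has_value_ev q (v : 'I_3 -> K) : has_value_at (ev q) v q.@[v].
Proof.
exists q, 1; split; rewrite ?rmorph1 ?oner_neq0 ?divr1 //.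
Qed.

(** If q = a/b as functions, then q b - a lies in the ideal of the curve and vanishes at every
    rational point. *)
Lemma has_value_unique q i c : has_value_at (ev q) (Q i) c -> c = q.@[Q i].
Proof.
move=> [a [b [bQ b0 e ->]]]; have : ev (q * b - a) = 0.
  by rewrite rmorphB rmorphM /= e divfK // subrr.
move=> /(ff_eval_mmap idfun (GK_pointP i)); rewrite rmorphB rmorphM /= -!meval_mmap.
by move/eqP; rewrite subr_eq0 => /eqP <-; rewrite mulfK.
Qed.

Lemma ag_code_ev q :
  riemann_roch_space (Pinf_divisor F (m * (l ^ 3 + 1))%N%:Z) (ev q) ->
  \row_i q.@[Q i] \in C.
Proof.
move=> RRq; rewrite inE; apply/asboolP; exists (ev q) => // i.
by rewrite mxE; apply: has_value_ev.
Qed.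

(** If the weight were at most m+1, a product of at most m linear factors would vanish at all points
    of the support but one; its inner product with [c] would be a single nonzero term. *)
Lemma dual_weight_ge c : c \in dual_code C -> c != 0 -> (m + 2 <= hamming_weight c)%N.
Proof.
rewrite inE => /forallP dual c0; rewrite leqNgt addn2 ltnS; apply/negP => w_le.
pose S := [set i | c 0 i != 0].
have [i0 Si0] : exists i, i \in S.
  apply: contrapT => no; case/negP: c0; apply/eqP/rowP => i; rewrite mxE.
  by apply/eqP; apply: contrapT => /negP ci; apply: no; exists i; rewrite inE.
(* A coordinate separating the points i and i0; the default occurs only at i = i0. *)
pose k i := odflt iX [pick u | Q i u != Q i0 u].
have kP i : i != i0 -> Q i (k i) != Q i0 (k i).
  rewrite /k; case: pickP => //= same ne; case/negP: ne; apply/eqP/GK_point_inj/ffunP => u.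
  by apply/eqP; have /negbFE := same u.
pose r := [seq (k i, Q i (k i)) | i <- enum (S :\ i0)].
pose q : {mpoly K[3]} := \prod_(u <- r) ('X_u.1 - u.2%:MP).
have evq : ev q = \prod_(u <- r) (ff_coord F u.1 - cF u.2).
  rewrite /q rmorph_prod; apply: eq_bigr => u _.
  by rewrite rmorphB /= ff_evalX ff_evalC.
have qQ (v : 'I_3 -> K) : q.@[v] = \prod_(u <- r) (v u.1 - u.2).
  rewrite /q meval_mmap rmorph_prod; apply: eq_bigr => u _.
  by rewrite rmorphB /= mmapX mmap1U mmapC.
have Cq : \row_i q.@[Q i] \in C.
  apply: ag_code_ev; rewrite evq; apply: (riemann_roch_prod hp hh hl hK).
  rewrite size_map -cardE -ltnS.
  by apply: leq_trans w_le; rewrite /hamming_weight -/S [X in (_ < X)%N](cardsD1 i0) Si0.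
have := dual (\row_i q.@[Q i]); rewrite Cq /= (bigD1 i0) //= mxE big1 ?addr0.
  rewrite mulf_eq0 => /orP[]; first by apply/negP; rewrite inE in Si0.
  apply/negP; rewrite qQ big_map big_enum; apply/prodf_neq0 => i; rewrite !inE => /andP[ne_i _].
  by rewrite subr_eq0 eq_sym kP.
move=> i ne_i; rewrite mxE; have [->|ci] := eqVneq (c 0 i) 0; first by rewrite mul0r.
have ri : i \in enum (S :\ i0) by rewrite mem_enum !inE ne_i.
by rewrite qQ big_map (big_rem i ri) /= subrr mul0r mulr0.
Qed.

Definition vertical_line (u : K * K) : {set 'I_#|GK_affine_points l K|} :=
  [set i | (Q i iX == u.2) && (Q i iY == u.1)].

Lemma vertical_line_inj u : {in vertical_line u &, injective (fun i => Q i iZ)}.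
Proof.
move=> i j; rewrite !inE => /andP[/eqP xi /eqP yi] /andP[/eqP xj /eqP yj] zij.
apply/GK_point_inj/ffunP => k.
by case: (ord3_case k) => ->; rewrite ?xi ?xj ?yi ?yj.
Qed.

Lemma card_vertical_line u : u \in lineset l K -> #|vertical_line u| = N.
Proof.
rewrite inE => /andP[Bu]; rewrite inE => /eqP eY.
have Ww : u.1 ^+ (l ^ 2) - u.1 \in wset l K by rewrite inE in Bu.
rewrite -(card_line_points hp hh hl hK Ww) -(card_in_imset (@vertical_line_inj u)).
apply: eq_card => c; rewrite [in RHS]inE; apply/imsetP/eqP.
  move=> [i]; rewrite inE => /andP[/eqP xi /eqP yi] ->.
  by have [-> _] := GK_pointP i; rewrite yi.
move=> eZ; have [|i iE] := @GK_point_surj u.2 u.1 c.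
  by rewrite /on_GK pt3X pt3Y pt3Z.
by exists i; rewrite ?inE iE ?pt3X ?pt3Y ?pt3Z ?eqxx.
Qed.

Definition line_word (T : {set 'I_#|GK_affine_points l K|}) (a : K) :
    'rV[K]_#|GK_affine_points l K| :=
  \row_i if i \in T then a * lagrange_weight (fun i => Q i iZ) T i else 0.

Section OneWord.
Variables (u : K * K) (T : {set 'I_#|GK_affine_points l K|}) (a : K).
Hypotheses (sub_T : T \subset vertical_line u) (card_T : #|T| = (m + 2)%N).

Let inj_T : {in T &, injective (fun i => Q i iZ)}.
Proof.
by move=> i j Ti Tj; apply: (@vertical_line_inj u); apply: (subsetP sub_T).
Qed.

(** On the line a function of the Riemann-Roch space is a polynomial in z of degree at most m, which
    is less than #|T| - 1, so [lagrange_orthogonal] applies. *)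
Lemma line_word_dual : line_word T a \in dual_code C.
Proof.
rewrite inE; apply/forallP => c'; apply/implyP; rewrite inE => /asboolP[f RRf fQ].
have [s fE sz_s] := riemann_roch_basis_sum hp hh hl hK m_small RRf.
pose q : {mpoly K[3]} := \sum_(i < l) \sum_(j < l ^ 2) (map_poly (@mpolyC 3 K) (s i j)).['X_iZ] * 'X_iX ^+ i * 'X_iY ^+ j.
have evq : f = ev q.
  rewrite fE /basis_sum rmorph_sum; apply: eq_bigr => i _ /=.
  rewrite rmorph_sum; apply: eq_bigr => j _ /=.
  by rewrite !rmorphM !rmorphXn /= -zpoly_ev !ff_evalX.
(* The restriction of [f] to the line, obtained by putting x = [u.2] and y = [u.1] in the basis
   sum. *)
pose g : {poly K} := \sum_(i < l) \sum_(j < l ^ 2) (u.2 ^+ i * u.1 ^+ j) *: s i j.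
have sz_g : (size g < #|T|)%N.
  rewrite card_T addn2 ltnS; apply: leq_trans (size_sum _ _ _) _.
  apply/bigmax_leqP => i _; apply: leq_trans (size_sum _ _ _) _.
  apply/bigmax_leqP => j _; exact: leq_trans (size_scale_leq _ _) (sz_s i j).
have c'E i : i \in T -> c' 0 i = g.[Q i iZ].
  move=> Ti; have := fQ i; rewrite evq => /has_value_unique->.
  have := subsetP sub_T i Ti; rewrite inE => /andP[/eqP ex /eqP ey].
  rewrite meval_mmap /q rmorph_sum /g -ex -ey horner_sum; apply: eq_bigr => i' _ /=.
  rewrite rmorph_sum horner_sum; apply: eq_bigr => j' _ /=.
  rewrite !rmorphM !rmorphXn /= mmap_horner !mmapX !mmap1U hornerZ.
  by rewrite map_poly_id // -mulrA mulrC.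
rewrite (bigID (mem T)) /= [X in _ + X]big1 ?addr0; last first.
  by move=> i /negbTE nTi; rewrite mxE nTi mul0r.
apply/eqP; transitivity
  (a * \sum_(i in T) lagrange_weight (fun i => Q i iZ) T i * g.[Q i iZ]).
  by rewrite mulr_sumr; apply: eq_bigr => i Ti; rewrite mxE Ti c'E // mulrA.
by rewrite (lagrange_orthogonal inj_T sz_g) mulr0.
Qed.

Lemma line_word_support : a != 0 -> [set i | line_word T a 0 i != 0] = T.
Proof.
move=> a0; apply/setP => i; rewrite inE mxE; case: ifP => [Ti|]; last by rewrite eqxx.
by rewrite mulf_neq0 // lagrange_weight_neq0.
Qed.

Lemma line_word_weight : a != 0 -> hamming_weight (line_word T a) = (m + 2)%N.
Proof. by move=> a0; rewrite /hamming_weight line_word_support. Qed.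

End OneWord.

Lemma line_word_support_gt0 (T : {set 'I_#|GK_affine_points l K|}) :
  #|T| = (m + 2)%N -> exists i, i \in T.
Proof. by move=> cT; apply/card_gt0P; rewrite cT addn2. Qed.

Definition line_word_data :
    {set (K * K) * {set 'I_#|GK_affine_points l K|} * K} :=
  setX [set w | (w.1 \in lineset l K) &&
          (w.2 \in [set T : {set _} | (T \subset vertical_line w.1) & #|T| == (m + 2)%N])]
       [set a | a != 0].

Lemma card_line_word_data : #|line_word_data| =
  ((l + 1) * (l ^ 5 - l ^ 3) * 'C(N, m + 2) * (l ^ 6 - 1))%N.
Proof.
rewrite cardsX (@card_dependent_pairs _ _ (lineset l K)
  (fun w => [set T : {set _} | (T \subset vertical_line w) & #|T| == (m + 2)%N])
  'C(N, m + 2)); last first.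
  by move=> u Lu; rewrite cards_draws card_vertical_line.
rewrite (card_lineset hp hh hl hK); congr (_ * _)%N.
have -> : [set a : K | a != 0] = [set~ 0] by apply/setP => a; rewrite !inE.
by rewrite cardsC1 hK subn1.
Qed.

(** The support of the word is T, any point of T determines the line, and the entry at that point
    determines the scalar. *)
Lemma line_word_inj :
  {in line_word_data &, injective (fun w => line_word w.1.2 w.2)}.
Proof.
move=> [[u T] a] [[u' T'] a']; rewrite !inE /=.
move=> /andP[/andP[_ /andP[sT /eqP cT]] a0] /andP[/andP[_ /andP[sT' /eqP cT']] a0'] e.
have eT : T = T'.
  by rewrite -(line_word_support sT a0) -(line_word_support sT' a0') e.
subst T'; have [i Ti] := line_word_support_gt0 cT.
have eu : u = u'.
  have := subsetP sT i Ti; have := subsetP sT' i Ti; rewrite !inE.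
  move=> /andP[/eqP x' /eqP y'] /andP[/eqP x1 /eqP y1].
  by rewrite [u]surjective_pairing [u']surjective_pairing -x' -y' -x1 -y1.
subst u'; congr (_, _, _).
have := congr1 (fun c : 'rV[K]__ => c 0 i) e; rewrite !mxE Ti => /mulIf; apply.
apply: lagrange_weight_neq0 => //.
by move=> j k Tj Tk; apply: (@vertical_line_inj u); apply: (subsetP sT).
Qed.

Lemma min_distance_dual : min_distance (dual_code C) = (m + 2)%N.
Proof.
apply: min_distance_eq; last exact: dual_weight_ge.
have : (0 < #|line_word_data|)%N.
  have lt35 : (l ^ 3 < l ^ 5)%N by rewrite ltn_exp2l.
  have lt06 : (l ^ 0 < l ^ 6)%N by rewrite ltn_exp2l.
  (* The upper bound on m leaves room for m+2 points on a line, so a word of this weight exists. *)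
  have le_N : (m + 2 <= N)%N by move: hm; lia.
  rewrite card_line_word_data !muln_gt0 bin_gt0 le_N !subn_gt0 lt35.
  by rewrite expn0 in lt06; rewrite lt06 addn1.
case/card_gt0P => -[[u T] a]; rewrite !inE /=.
move=> /andP[/andP[_ /andP[sT /eqP cT]] a0].
exists (line_word T a); split; first exact: line_word_dual sT cT.
  have [i Ti] := line_word_support_gt0 cT.
  apply: contraTneq Ti => e; rewrite -(line_word_support sT a0) e.
  by rewrite inE mxE eqxx.
exact: line_word_weight sT cT a0.
Qed.

Lemma weight_count_dual :
  ((l + 1) * (l ^ 5 - l ^ 3) * (l ^ 6 - 1) * 'C(N, m + 2) <=
   weight_count (dual_code C) (m + 2))%N.
Proof.
rewrite mulnAC -card_line_word_data -(card_in_imset line_word_inj).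
apply/subset_leq_card/subsetP => _ /imsetP[[[u T] a] + ->]; rewrite !inE /=.
move=> /andP[/andP[_ /andP[sT /eqP cT]] a0].
have := line_word_dual a sT cT; rewrite inE => ->.
by rewrite (line_word_weight sT cT a0) eqxx.
Qed.

End Code.

Local Close Scope ring_scope.

Theorem theorem4p4 (p h l m : nat) (hp : prime p) (hh : 0 < h)
    (hl : l = p ^ h) (K : finFieldType) (hK : #|K| = l ^ 6)
    (F : GK_function_field l K)
    (hm : 2 * (l - 1) < m < l ^ 2 - l - 1) :
  let C := dual_code (ag_code (Pinf_divisor F (Posz (m * (l ^ 3 + 1))))) in
  let d := min_distance C in
  (l + 1) * (l ^ 5 - l ^ 3) * (l ^ 6 - 1) * 'C(l ^ 2 - l + 1, d)
    <= weight_count C d.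
Proof.
case/andP: hm => _ lt_m.
have := weight_count_dual hp hh hl hK F lt_m.
by rewrite -(min_distance_dual hp hh hl hK F lt_m).
Qed.
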